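(* For $\mu,\mu'\in\mathbb{R}$ let $\mathcal{R}_\mu,\mathcal{R}_{\mu'}$ be the recursion operators described below and $S_\rho,S_{\rho'}$ the corresponding odd symmetries of the covering space $W$. Then their Nijenhuis bracket vanishes: $[\![\rho,\rho']\!]=0$ for all $\mu,\mu'\in\mathbb{R}$. That is, the recursion operators $\mathcal{R}_\mu$ pairwise commute with respect to the Nijenhuis bracket.
   Context: Let $\mathcal{E}$ be $u_{tx}=2u_yu_{xx}+4u_xu_{xy}-u_{xxxy}$. Its tangent equation $\mathcal{T}\mathcal{E}$ is $\mathcal{E}$ together with $q_{tx}=2u_yq_{xx}+2u_{xx}q_y+4u_xq_{xy}+4u_{xy}q_x-q_{xxxy}$, the $q_\sigma$ being odd (parity 1); it carries the odd nilpotent field $\mathrm{d}_{\mathcal{C}}$, $\mathrm{d}_{\mathcal{C}}(u_\sigma)=q_\sigma$, $\mathrm{d}_{\mathcal{C}}(q_\sigma)=0$. $W$ is the covering of $\mathcal{T}\mathcal{E}$ with odd nonlocal variable $w$, $w_x=2u_xq_x$, $w_y=q_t+q_{xxy}-2u_xq_y-2u_yq_x$. For $\mu\in\mathbb{R}$, $\gamma=1-\mu t$, the recursion operator $\mathcal{R}_\mu$ (defined by $\Psi_x=\gamma(4u_x\Phi_x+2u_{xx}\Phi-\Phi_{xxx})-\mu y\Phi_x$, $\Psi_y=\gamma(\Phi_t-2u_y\Phi_x+2u_{xy}\Phi)-\mu(y\Phi_y+\Phi)$) is encoded by $\rho=S^u=(2\gamma u_x-\mu y)q-\gamma q_{xx}+\gamma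 w$, and $S_\rho$ is the unique odd symmetry of $W$ with $u$-component $\rho$, namely $S_\rho=\sum_\sigma D_\sigma(S^u)\partial_{u_\sigma}+\sum_\sigma D_\sigma(S^q)\partial_{q_\sigma}+S^w\partial_w$. The Nijenhuis bracket $[\![\rho,\rho']\!]$ is defined by $[S_\rho,S_{\rho'}]=S_{[\![\rho,\rho']\!]}$, where for odd fields the super-commutator is $[S_\rho,S_{\rho'}]=S_\rho\circ S_{\rho'}+S_{\rho'}\circ S_\rho$; equivalently $[\![\rho,\rho']\!]=S_\rho(\rho')+S_{\rho'}(\rho)$.
   Formalization: The odd symmetry with u-component rho is not unique by parity alone (S^u=0, S^q=u_x, S^w=u_x^2 may be added), so S_rho is taken among symmetries whose q- and w-components have degree two in the odd variables q_sigma, w. *)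

(* Defs.v *)
(* A concrete model of the algebra of (polynomial) functions
   on the covering W of the tangent covering TE of
      E :  u_tx = 2 u_y u_xx + 4 u_x u_xy - u_xxxy .
   Functions on W are modelled as the free supercommutative R-algebra on the
   jet variables t, x, y (even), u_sigma (even), q_sigma (odd), w_sigma (odd)
   (sigma = (k,i,j) = orders of differentiation in t, x, y), taken modulo the
   differential ideal I_W generated by E, its linearization (the q-equation),
   and the two defining relations of the nonlocal variable w. *)
From HB Require Import structures.
From mathcomp Require Import all_boot all_order all_algebra.
Set Implicit Arguments. Unset Strict Implicit. Unset Printing Implicit Defensive.
Import Order.TTheory GRing.Theory.
Local Open Scope ring_scope.

(* multi-indices (k, i, j) : derivative of order k in t, i in x, j in y *)
Definition midx := (nat * nat * nat)%type.

Inductive var := Vt | Vx | Vy | VU of midx | VQ of midx | VW of midx.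

Definition var_enc (v : var) : nat * midx :=
  match v with
  | Vt => (0%N, (0%N, 0%N, 0%N)) | Vx => (1%N, (0%N, 0%N, 0%N))
  | Vy => (2%N, (0%N, 0%N, 0%N))
  | VU s => (3%N, s) | VQ s => (4%N, s) | VW s => (5%N, s) end.
Definition var_dec (p : nat * midx) : var :=
  match p.1 with
  | 0 => Vt | 1 => Vx | 2 => Vy | 3 => VU p.2 | 4 => VQ p.2 | _ => VW p.2 end%N.
Lemma var_encK : cancel var_enc var_dec. Proof. by case. Qed.
HB.instance Definition _ := Countable.copy var (can_type var_encK).

Definition odd_var (v : var) : bool :=
  match v with VQ _ | VW _ => true | _ => false end.

Section Poly.
Variable R : comRingType.

(* a (representative of a) superpolynomial: a formal sum of coefficient times
   an ordered word of variables *)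
Definition spoly := seq (R * seq var).

Definition pc (c : R) : spoly := [:: (c, [::])].
Definition pv (v : var) : spoly := [:: (1, [:: v])].
Definition padd (p q : spoly) : spoly := p ++ q.
Definition pscale (c : R) (p : spoly) : spoly := [seq (c * tm.1, tm.2) | tm <- p].
Definition psub (p q : spoly) : spoly := padd p (pscale (-1) q).
Definition pmul (p q : spoly) : spoly :=
  [seq (a.1 * b.1, a.2 ++ b.2) | a <- p, b <- q].

(* semantics: the free supercommutative algebra.  A word is brought to the
   normal form (sorted word) with the Koszul sign; it vanishes if an odd
   variable occurs twice. *)
Definition vle (a b : var) : bool := (pickle a <= pickle b)%N.
Definition nf (s : seq var) : seq var := sort vle s.
Fixpoint inversions (s : seq var) : nat :=
  match s with
  | [::] => 0%N
  | v :: s' => ((if odd_var v then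
                 count (fun w => odd_var w && (pickle w < pickle v)%N) s'
                else 0) + inversions s')%N
  end.
Definition dup_odd (s : seq var) : bool :=
  has (fun v => odd_var v && (1 < count_mem v s)%N) s.
Definition sgnw (s : seq var) : R :=
  if dup_odd s then 0 else (-1) ^+ inversions s.

Definition coeff (p : spoly) (m : seq var) : R :=
  \sum_(tm <- p) (if nf tm.2 == m then sgnw tm.2 * tm.1 else 0).
Definition peq (p q : spoly) : Prop := forall m, coeff p m = coeff q m.

Fixpoint der_word (od : bool) (f : var -> spoly) (s : seq var) : spoly :=
  match s with
  | [::] => [::]
  | v :: s' => padd (pmul (f v) [:: (1, s')])
                   (pscale (if od && odd_var v then -1 else 1)
                           (pmul (pv v) (der_word od f s')))
  end.
Definition der (od : bool) (f : var -> spoly) (p : spoly) : spoly :=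
  flatten [seq pscale tm.1 (der_word od f tm.2) | tm <- p].

(* total derivatives: direction 0 = t, 1 = x, 2 = y *)
Definition shift (d : nat) (s : midx) : midx :=
  match d with
  | 0 => (s.1.1.+1, s.1.2, s.2)
  | 1 => (s.1.1, s.1.2.+1, s.2)
  | _ => (s.1.1, s.1.2, s.2.+1) end%N.
Definition Dvar (d : nat) (v : var) : spoly :=
  match v with
  | Vt => if d == 0%N then pc 1 else [::]
  | Vx => if d == 1%N then pc 1 else [::]
  | Vy => if d == 2%N then pc 1 else [::]
  | VU s => pv (VU (shift d s))
  | VQ s => pv (VQ (shift d s))
  | VW s => pv (VW (shift d s)) end.
Definition TD (d : nat) (p : spoly) : spoly := der false (Dvar d) p.
Definition Dms (s : midx) (p : spoly) : spoly :=
  iter s.1.1 (TD 0) (iter s.1.2 (TD 1) (iter s.2 (TD 2) p)).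

Definition Evar (a b c : spoly) (v : var) : spoly :=
  match v with
  | VU s => Dms s a | VQ s => Dms s b | VW s => Dms s c | _ => [::] end.
Definition ev (a b c : spoly) (p : spoly) : spoly := der true (Evar a b c) p.

Definition U k i j : spoly := pv (VU (k, i, j)).
Definition Q k i j : spoly := pv (VQ (k, i, j)).
Definition Wn k i j : spoly := pv (VW (k, i, j)).
Definition cst (n : nat) : spoly := pc n%:R.

Definition eqE : spoly :=
  padd (psub (psub (U 1 1 0) (pmul (cst 2) (pmul (U 0 0 1) (U 0 2 0))))
             (pmul (cst 4) (pmul (U 0 1 0) (U 0 1 1))))
       (U 0 3 1).
Definition eqTE : spoly :=
  padd (psub (psub (psub (psub (Q 1 1 0)
        (pmul (cst 2) (pmul (U 0 0 1) (Q 0 2 0))))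
        (pmul (cst 2) (pmul (U 0 2 0) (Q 0 0 1))))
        (pmul (cst 4) (pmul (U 0 1 0) (Q 0 1 1))))
        (pmul (cst 4) (pmul (U 0 1 1) (Q 0 1 0))))
       (Q 0 3 1).
Definition eqWx : spoly :=
  psub (Wn 0 1 0) (pmul (cst 2) (pmul (U 0 1 0) (Q 0 1 0))).
Definition eqWy : spoly :=
  psub (Wn 0 0 1)
       (psub (psub (padd (Q 1 0 0) (Q 0 2 1))
                   (pmul (cst 2) (pmul (U 0 1 0) (Q 0 0 1))))
             (pmul (cst 2) (pmul (U 0 0 1) (Q 0 1 0)))).

Definition gensW : seq spoly := [:: eqE; eqTE; eqWx; eqWy].

(* membership in the differential ideal generated by gensW, i.e. the function
   vanishes on W *)
Definition in_IW (p : spoly) : Prop :=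
  exists l : seq (spoly * midx * nat),
    peq p (flatten [seq pmul x.1.1 (Dms x.1.2 (nth [::] gensW x.2)) | x <- l]).

Definition is_symW (a b c : spoly) : Prop :=
  forall g, g \in gensW -> in_IW (ev a b c g).

Definition odd_deg2 (p : spoly) : Prop :=
  forall m, count odd_var m != 2%N -> coeff p m = 0.

Definition gam (mu : R) : spoly := padd (pc 1) (pscale (- mu) (pv Vt)).
Definition rho (mu : R) : spoly :=
  padd (psub (pmul (psub (pmul (cst 2) (pmul (gam mu) (U 0 1 0)))
                          (pscale mu (pv Vy)))
                    (Q 0 0 0))
             (pmul (gam mu) (Q 0 2 0)))
       (pmul (gam mu) (Wn 0 0 0)).

Definition nij (rho1 b1 c1 rho2 b2 c2 : spoly) : spoly :=
  padd (ev rho1 b1 c1 rho2) (ev rho2 b2 c2 rho1).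

End Poly.

(* Main.v *)
(* Existence is explicit: with g = 1 - mu t, the pair Sq = 2 g q q_x,
   Sw = 4 g u_x q q_x + 2 g q_x q_xx (Sq is minus the odd differential d_C of rho)
   completes rho to a symmetry, and with these components the bracket reduces to
   4 g g' (w_x - 2 u_x q_x) q.  Everything therefore rests on uniqueness: a pair
   (f, h) of odd degree 2 with
     h_x = 2 u_x f_x,   h_y = f_t + f_xxy - 2 u_x f_y - 2 u_y f_x   on W
   vanishes on W.  Put u = x^2/2 + v.  In internal coordinates the component of
   (f, h) of lowest degree in v solves the same equations for the system linearized
   at v = 0.  That system has coordinates Z_(s,m) (m counting x-derivatives) in which
   d/dx is a pure shift.  There psi = x f - h/2 satisfies psi_x = f and
   psi_tx = 4 x psi_xy - 2 psi_y - psi_xxxy; the derivative of this equation with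
   respect to the odd coordinate Z_(s+1,m+3), where (s,m) is the top index occurring
   in psi, says that d psi/d Z_(s,m) is killed by d/dx, hence zero. *)
Require Import Defs.
From HB Require Import structures.
From mathcomp Require Import all_boot all_order all_algebra.
From mathcomp Require Import generic_quotient boolp reals.
From mathcomp Require Import zify ring.
Set Implicit Arguments. Unset Strict Implicit. Unset Printing Implicit Defensive.
Import Order.TTheory GRing.Theory Num.Theory.
Local Open Scope ring_scope.

(** * The free supercommutative algebra *)

(** The base point x^2/2 is chosen because at u = 0 the linearized relation for w reads w_x = 0:
    then w and its t-derivatives are killed by d/dx and the kernel argument breaks down. At x^2/2
    one has w_x = 2 x q_x, so z = x q - w/2 satisfies z_x = q and replaces the two letters q and w.
    Both u and this z solve z_tx = (4 - 2c) z_y + 4 x z_xy - z_xxxy, with c = 1 and c = 3. Setting c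
    z_1 = z_t - 4 x z_y + z_xxy gives d/dx z_1 = - 2 z_y, and z_1 solves the same equation with c +
    2. Iterating yields z_s with parameter c + 2s; y- and t-derivatives of z_s are combinations of
    z_(s+1) and its x-derivatives. The coordinates are Z_(s,m) = dx^m z_s. Odd degree at least two
    matters: a derivative by an odd Z then still has positive odd degree, where d/dx has no kernel,
    whereas in degree one Z_(0,0) itself is a solution. Lowest components belong to elements and not
    to classes modulo the ideal. This is why ideal membership is turned into a normal form,
    compatible with passage to the linearized system. *)

Section Sorting.
Variable R : numFieldType.

Lemma vle_total : total vle.
Proof. by move=> a b; rewrite /vle leq_total. Qed.
Lemma vle_trans : transitive vle.
Proof. by move=> a b c; exact: leq_trans. Qed.
Lemma vle_anti : antisymmetric vle.
Proof.
move=> a b; rewrite /vle -eqn_leq => /eqP.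
exact: (pcan_inj pickleK).
Qed.

Lemma nf_perm s t : perm_eq s t -> nf s = nf t.
Proof. by move/(perm_sortP vle_total vle_trans vle_anti). Qed.

Lemma inversions_perm_tail (v : var) s t : perm_eq s t ->
  count (fun w : var => odd_var w && (pickle w < pickle v)%N) s =
  count (fun w : var => odd_var w && (pickle w < pickle v)%N) t.
Proof. by move/permP. Qed.

Lemma dup_odd_perm s t : perm_eq s t -> dup_odd s = dup_odd t.
Proof.
move=> st; rewrite /dup_odd (perm_has _ st).
by apply: eq_has => v; rewrite (permP st).
Qed.

Lemma dup_odd_ht s1 a s2 : odd_var a -> dup_odd (s1 ++ a :: a :: s2).
Proof.
move=> oa; apply/hasP; exists a; first by rewrite mem_cat inE eqxx orbT.
rewrite oa /= count_cat /= eqxx; lia.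
Qed.

Lemma perm_swap (s1 : seq var) a b s2 : perm_eq (s1 ++ a :: b :: s2) (s1 ++ b :: a :: s2).
Proof. by rewrite perm_cat2l; apply/permP => p /=; lia. Qed.

(** Repetition of an odd letter is insensitive to the order, so only words without it matter; there
    the swap of two distinct odd letters changes the number of inversions by exactly one, in a
    direction given by their codes. *)
Lemma sgnw_swap s1 a b s2 :
  sgnw R (s1 ++ a :: b :: s2) =
  (-1) ^+ (odd_var a && odd_var b) * sgnw R (s1 ++ b :: a :: s2).
Proof.
rewrite /sgnw (dup_odd_perm (perm_swap s1 a b s2)).
case: (boolP (dup_odd _)) => [|nd]; first by rewrite mulr0.
elim: s1 nd => [|v s1 IH] /= nd; last first.
  have nd' : ~~ dup_odd (s1 ++ b :: a :: s2).
    apply: contra nd => /hasP [w win /andP[ow cw]].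
    apply/hasP; exists w; rewrite ?inE ?win ?orbT //= ow (leq_trans cw) ?leq_addl ?orbT //.
  rewrite exprD IH // exprD mulrCA; congr (_ * (_ * _)).
  by congr (_ ^+ _); case: (odd_var v) => //; apply: inversions_perm_tail; apply: perm_swap.
case: (eqVneq a b) => [ab|ab].
  subst b; case oa: (odd_var a); last by rewrite mul1r.
  by rewrite (dup_odd_ht [::] s2 oa) in nd.
have pab : pickle a <> pickle b.
  by move=> /(pcan_inj pickleK) e; rewrite e eqxx in ab.
case oa: (odd_var a); case ob: (odd_var b) => /=; rewrite ?mul1r ?expr1 //;
  try by (congr (_ ^+ _); lia).
rewrite -exprS -[LHS]signr_odd -[RHS]signr_odd; congr (_ ^+ (_ : bool)).
by case: (ltngtP (pickle a) (pickle b)) => //= H; lia.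
Qed.

(** The condition for a function on words to descend to the supercommutative algebra. Adjacent swaps
    suffice, since sorting is composed of them. *)
Definition supersym (V : lmodType R) (G : seq var -> V) :=
  forall s1 a b s2, G (s1 ++ a :: b :: s2) =
    (-1) ^+ (odd_var a && odd_var b) *: G (s1 ++ b :: a :: s2).

Lemma nf_cons v s : nf (v :: s) =
  [seq x <- nf s | ~~ vle v x] ++ v :: [seq x <- nf s | vle v x].
Proof.
have sn : pairwise vle (nf s) by rewrite -(sorted_pairwise vle_trans) sort_sorted //; exact: vle_total.
apply: (sorted_eq vle_trans vle_anti).
- by rewrite sort_sorted //; exact: vle_total.
- rewrite (sorted_pairwise vle_trans) pairwise_cat /= !pairwise_filter // andbT /=.
  rewrite all_filter; apply/andP; split=> //; last by apply/allP => x _ /=; exact: implybb.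
  apply/allrelP => x y; rewrite mem_filter => /andP[vx _].
  have xv : vle x v by have := vle_total v x; rewrite (negbTE vx).
  rewrite inE => /predU1P[->//|]; rewrite mem_filter => /andP[vy _].
  exact: vle_trans vy.
- rewrite perm_sort perm_sym.
  apply: (@perm_trans _ (v :: ([seq x <- nf s | ~~ vle v x] ++ [seq x <- nf s | vle v x]))).
    by apply/permP => p /=; rewrite !count_cat /=; lia.
  rewrite perm_cons; apply: perm_trans (_ : perm_eq (nf s) s); last by rewrite perm_sort.
  by rewrite perm_catC perm_filterC.
Qed.

Lemma nf_split v s : nf s =
  [seq x <- nf s | ~~ vle v x] ++ [seq x <- nf s | vle v x].
Proof.
have sn : pairwise vle (nf s) by rewrite -(sorted_pairwise vle_trans) sort_sorted //; exact: vle_total.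
apply: (sorted_eq vle_trans vle_anti).
- by rewrite sort_sorted //; exact: vle_total.
- rewrite (sorted_pairwise vle_trans) pairwise_cat /= !pairwise_filter // !andbT.
  apply/allrelP => x y; rewrite !mem_filter => /andP[vx _] /andP[vy _].
  have xv : vle x v by have := vle_total v x; rewrite (negbTE vx).
  exact: vle_trans vy.
- by rewrite perm_sym perm_catC perm_filterC.
Qed.

Lemma supersym_move (V : lmodType R) (G : seq var -> V) : supersym G ->
  forall t s1 v s2, G (s1 ++ v :: t ++ s2) =
   (-1) ^+ (if odd_var v then count odd_var t else 0) *: G (s1 ++ t ++ v :: s2).
Proof.
move=> HG; elim=> [|a t IH] s1 v s2 /=; first by case: ifP; rewrite scale1r.
rewrite HG; have := IH (rcons s1 a) v s2; rewrite !cat_rcons => ->.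
rewrite scalerA -exprD; congr (_ ^+ _ *: _).
by case: (odd_var v); case: (odd_var a).
Qed.

(** Sort the tail, then move the head past the smaller letters: the odd ones among these are what
    [inversions] counts for the head. *)
Lemma supersym_inv (V : lmodType R) (G : seq var -> V) : supersym G ->
  forall s s1, G (s1 ++ s) = (-1) ^+ (inversions s) *: G (s1 ++ nf s).
Proof.
move=> HG; elim=> [|v s IH] s1 /=; first by rewrite scale1r.
rewrite -cat_rcons IH cat_rcons [in LHS](nf_split v s) (supersym_move HG) nf_cons.
rewrite scalerA -exprD addnC; congr (_ ^+ (_ + _) *: _).
case: (odd_var v) => //; rewrite count_filter -(permP (_ : perm_eq (nf s) s)) ?perm_sort //.
by apply: eq_count => x /=; rewrite /vle -ltnNge.
Qed.

Lemma eqN_scale0 (V : lmodType R) (x : V) : x = - x -> x = 0.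
Proof.
move=> e; have: (2%:R : R) *: x = 0 by rewrite scaler_nat mulr2n {1}e addNr.
by move/eqP; rewrite scaler_eq0 pnatr_eq0 /= => /eqP.
Qed.

(** Bring two copies of the odd letter to the front; swapping them gives [G = - G], and 2 is
    invertible. *)
Lemma supersym_dup (V : lmodType R) (G : seq var -> V) : supersym G ->
  forall s, dup_odd s -> G (nf s) = 0.
Proof.
move=> HG s /hasP [v vs /andP[ov cv]].
have p1 : perm_eq s (v :: rem v s) by exact: perm_to_rem.
have vs' : v \in rem v s.
  rewrite -has_pred1 has_count; have := permP p1 (pred1 v); rewrite /= eqxx => e; rewrite e in cv; lia.
have p2 : perm_eq s (v :: v :: rem v (rem v s)).
  by apply: perm_trans p1 _; rewrite perm_cons; exact: perm_to_rem.
have G0 : G (v :: v :: rem v (rem v s)) = 0.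
  apply: eqN_scale0; rewrite [LHS](HG [::]) ov /= expr1 scaleN1r //.
have := supersym_inv HG (v :: v :: rem v (rem v s)) [::].
rewrite /= G0 -(nf_perm p2) => /esym/eqP; rewrite scaler_eq0 signr_eq0 /=.
by move/eqP.
Qed.

Lemma supersym_nf (V : lmodType R) (G : seq var -> V) : supersym G ->
  forall s, G s = sgnw R s *: G (nf s).
Proof.
move=> HG s; rewrite /sgnw; case: ifP => [d|_]; last exact: (supersym_inv HG s [::]).
have := supersym_inv HG s [::]; rewrite /= => ->.
by rewrite supersym_dup // scaler0 scale0r.
Qed.

Definition lin (V : lmodType R) (G : seq var -> V) (p : spoly R) : V :=
  \sum_(tm <- p) tm.1 *: G tm.2.

Lemma lin_coeff (V : lmodType R) (G : seq var -> V) : supersym G ->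
  forall (ms : seq (seq var)) (p : spoly R), uniq ms -> {subset map (fun tm => nf tm.2) p <= ms} ->
  lin G p = \sum_(m <- ms) coeff p m *: G m.
Proof.
move=> HG ms p ums; rewrite /lin /coeff; elim: p => [|tm p IH] sub.
  by rewrite big_nil big1_seq // => m _; rewrite big_nil scale0r.
rewrite big_cons IH; last by move=> m mp; apply: sub; rewrite inE mp orbT.
have nin : nf tm.2 \in ms by apply: sub; rewrite inE eqxx.
under [in RHS]eq_bigr => m _ do rewrite big_cons scalerDl.
rewrite big_split /=; congr (_ + _).
rewrite (bigD1_seq (nf tm.2)) //= eqxx big1 ?addr0; last first.
  by move=> m nm; rewrite eq_sym (negbTE nm) scale0r.
by rewrite mulrC -scalerA -supersym_nf.
Qed.

(** Both sides are expanded by [lin_coeff] over one common list of sorted words, after which only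
    coefficients occur. All maps out of the quotient rest on this. *)
Lemma lin_peq (V : lmodType R) (G : seq var -> V) p q : supersym G ->
  peq p q -> lin G p = lin G q.
Proof.
move=> HG pq; pose ms := undup (map (fun tm => nf tm.2) (p ++ q)).
rewrite !(@lin_coeff _ _ HG ms) ?undup_uniq //.
- by apply: eq_bigr => m _; rewrite pq.
- by move=> m mq; rewrite mem_undup map_cat mem_cat mq orbT.
- by move=> m mp; rewrite mem_undup map_cat mem_cat mp.
Qed.

End Sorting.

Section CoeffOps.
Variable R : numFieldType.
Implicit Types p q r : spoly R.

Lemma coeff_cat p q m : coeff (padd p q) m = coeff p m + coeff q m.
Proof. by rewrite /coeff big_cat. Qed.
Lemma coeff_scale c p m : coeff (pscale c p) m = c * coeff p m.
Proof.
rewrite /coeff big_map mulr_sumr; apply: eq_bigr => tm _ /=.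
by case: ifP => _; rewrite ?mulr0 // mulrCA.
Qed.
Lemma coeff_mul p q m : coeff (pmul p q) m =
  \sum_(a <- p) \sum_(b <- q) (if nf (a.2 ++ b.2) == m then sgnw R (a.2 ++ b.2) * (a.1 * b.1) else 0).
Proof. by rewrite /coeff /pmul big_allpairs_dep. Qed.

Lemma coeff_supersym m : supersym (V:=R^o) (fun s => if nf s == m then sgnw R s else 0).
Proof.
move=> s1 a b s2; rewrite (nf_perm (perm_swap s1 a b s2)) sgnw_swap.
by case: ifP => _; rewrite ?scaler0.
Qed.

(** Reads a coefficient of a product as a linear map of the left factor, so that [lin_peq] gives
    compatibility of the product with [peq] one factor at a time. *)
Lemma coeff_mull p q m : coeff (pmul p q) m =
  lin (V:=R^o) (fun s => coeff (pmul [:: (1, s)] q) m) p.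
Proof.
rewrite coeff_mul /lin; apply: eq_bigr => a _; rewrite coeff_mul big_seq1 /= scaler_sumr.
apply: eq_bigr => b _; case: ifP => _; last by rewrite scaler0.
by rewrite mul1r /GRing.scale /= mulrCA.
Qed.
Lemma coeff_mulr p q m : coeff (pmul p q) m =
  lin (V:=R^o) (fun s => coeff (pmul p [:: (1, s)]) m) q.
Proof.
rewrite coeff_mul exchange_big /lin; apply: eq_bigr => b _; rewrite coeff_mul scaler_sumr.
apply: eq_bigr => a _; rewrite big_seq1 /=; case: ifP => _; last by rewrite scaler0.
by rewrite mulr1 /GRing.scale /= (mulrC a.1) mulrCA.
Qed.

Lemma ifM (c : bool) (a b : R) : (if c then a * b else 0) = (if c then a else 0) * b.
Proof. by case: c; rewrite ?mul0r. Qed.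

Lemma peq_mul p p' q q' : peq p p' -> peq q q' -> peq (pmul p q) (pmul p' q').
Proof.
move=> hp hq m; transitivity (coeff (pmul p' q) m).
  rewrite !coeff_mull; apply: (@lin_peq R R^o _ _ _ _ hp) => s1 a b s2.
  rewrite !coeff_mul !big_seq1 /= scaler_sumr; apply: eq_bigr => tm _; rewrite -!catA !cat_cons.
  have := coeff_supersym m s1 a b (s2 ++ tm.2); rewrite /GRing.scale /= => e.
  by rewrite !ifM e -[LHS]mulrA.
rewrite !coeff_mulr; apply: (@lin_peq R R^o _ _ _ _ hq) => s1 a b s2.
rewrite !coeff_mul scaler_sumr; apply: eq_bigr => tm _; rewrite !big_seq1 /= !catA.
have := coeff_supersym m (tm.2 ++ s1) a b s2; rewrite /GRing.scale /= => e.
by rewrite !ifM e -[LHS]mulrA.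
Qed.
End CoeffOps.

(** * The quotient algebra and linear maps out of it *)

Definition peqb (R : numFieldType) (p q : spoly R) : bool := `[< peq p q >].
Lemma peqb_equiv (R : numFieldType) : equiv_class_of (@peqb R).
Proof.
split=> [p|p q|q p r].
- exact/asboolP.
- by apply/asboolP/asboolP => h m; rewrite h.
- by move=> /asboolP h /asboolP h'; apply/asboolP => m; rewrite h h'.
Qed.
Canonical peqb_rel (R : numFieldType) := EquivRelPack (peqb_equiv R).

Definition salg (R : numFieldType) := {eq_quot (peqb_rel R)}%qT.
HB.instance Definition _ (R : numFieldType) := Choice.on (salg R).

Definition cls (R : numFieldType) (p : spoly R) : salg R := (\pi_({eq_quot (peqb_rel R)}) p)%qT.
Definition rep (R : numFieldType) (x : salg R) : spoly R := (repr x)%qT.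

Section Algebra.
Variable R : numFieldType.
Implicit Types (p q r : spoly R) (x y z : salg R).

Lemma clsP p q : cls p = cls q <-> peq p q.
Proof. by split=> [/eqmodP/asboolP|h] //; apply/eqmodP/asboolP. Qed.
Lemma repK x : cls (rep x) = x. Proof. exact: reprK. Qed.
Lemma rep_cls p : peq (rep (cls p)) p.
Proof. by apply/clsP; rewrite repK. Qed.

Definition sadd x y := cls (padd (rep x) (rep y)).
Definition sopp x := cls (pscale (-1) (rep x)).
Definition smul x y := cls (pmul (rep x) (rep y)).
Definition sscale (c : R) x := cls (pscale c (rep x)).

Lemma cls_padd p q : cls (padd p q) = sadd (cls p) (cls q).
Proof. by apply/clsP => m; rewrite !coeff_cat !rep_cls. Qed.
Lemma cls_pscale c p : cls (pscale c p) = sscale c (cls p).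
Proof. by apply/clsP => m; rewrite !coeff_scale !rep_cls. Qed.
Lemma cls_pmul p q : cls (pmul p q) = smul (cls p) (cls q).
Proof. by apply/clsP/peq_mul => m; rewrite rep_cls. Qed.

Lemma cls_ind (P : salg R -> Prop) : (forall p, P (cls p)) -> forall x, P x.
Proof. by move=> h x; rewrite -(repK x). Qed.

Let coeffE := (coeff_cat, coeff_scale).
Fact saddA : associative sadd.
Proof.
elim/cls_ind=> p; elim/cls_ind=> q; elim/cls_ind=> r; rewrite -!cls_padd.
by apply/clsP=> m; rewrite !coeffE addrA.
Qed.
Fact saddC : commutative sadd.
Proof. by elim/cls_ind=> p; elim/cls_ind=> q; rewrite -!cls_padd; apply/clsP=> m; rewrite !coeffE addrC. Qed.
Fact sadd0 : left_id (cls [::]) sadd.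
Proof. by elim/cls_ind=> p; rewrite -cls_padd. Qed.
Fact saddN : left_inverse (cls [::]) sopp sadd.
Proof.
elim/cls_ind=> p; rewrite /sopp -/(sscale _ _) -cls_pscale -cls_padd; apply/clsP=> m.
by rewrite !coeffE mulN1r addNr /coeff big_nil.
Qed.
HB.instance Definition _ := GRing.isZmodule.Build (salg R) saddA saddC sadd0 saddN.

Fact smulA : associative smul.
Proof.
elim/cls_ind=> p; elim/cls_ind=> q; elim/cls_ind=> r; rewrite -!cls_pmul.
apply/clsP=> m; rewrite !coeff_mul [RHS]big_allpairs_dep /=; apply: eq_bigr => a _.
rewrite big_allpairs_dep /=; apply: eq_bigr => b _; apply: eq_bigr => c _.
by rewrite catA !mulrA.
Qed.
Fact smul1 : left_id (cls (pc 1)) smul.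
Proof.
elim/cls_ind=> p; rewrite -cls_pmul; congr cls.
by rewrite /pmul /= cats0 -[RHS]map_id; apply: eq_map => -[c s] /=; rewrite mul1r.
Qed.
Fact smul1r : right_id (cls (pc 1)) smul.
Proof.
elim/cls_ind=> p; rewrite -cls_pmul; congr cls; rewrite /pmul.
by elim: p => //= -[c s] p ->; rewrite mulr1 cats0.
Qed.
Fact smulDl : left_distributive smul sadd.
Proof.
elim/cls_ind=> p; elim/cls_ind=> q; elim/cls_ind=> r; rewrite -!(cls_padd, cls_pmul).
by apply/clsP=> m; rewrite !(coeff_cat, coeff_mul) big_cat.
Qed.
Fact smulDr : right_distributive smul sadd.
Proof.
elim/cls_ind=> p; elim/cls_ind=> q; elim/cls_ind=> r; rewrite -!(cls_padd, cls_pmul).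
apply/clsP=> m; rewrite !(coeff_cat, coeff_mul) -big_split /=.
by apply: eq_bigr => a _; rewrite big_cat.
Qed.
Fact sone_neq0 : cls (pc 1) != 0.
Proof.
apply/eqP=> /clsP /(_ [::]); rewrite /coeff big_seq1 big_nil /= /nf /sgnw /= mulr1.
by rewrite expr0 => /eqP; rewrite oner_eq0.
Qed.
HB.instance Definition _ := GRing.Zmodule_isNzRing.Build (salg R)
  smulA smul1 smul1r smulDl smulDr sone_neq0.

Fact sscaleA (a b : R) x : sscale a (sscale b x) = sscale (a * b) x.
Proof. by elim/cls_ind: x => p; rewrite -!cls_pscale; apply/clsP=> m; rewrite !coeffE mulrA. Qed.
Fact sscale1 : left_id 1 sscale.
Proof. by elim/cls_ind=> p; rewrite -!cls_pscale; apply/clsP=> m; rewrite !coeffE mul1r. Qed.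
Fact sscaleDr : right_distributive sscale +%R.
Proof.
move=> c; elim/cls_ind=> p; elim/cls_ind=> q; rewrite -[_ + _]cls_padd -!cls_pscale -[RHS]cls_padd.
by apply/clsP=> m; rewrite !coeffE mulrDr.
Qed.
Fact sscaleDl x : {morph sscale^~ x : a b / a + b}.
Proof.
move=> a b; elim/cls_ind: x => p; rewrite -!cls_pscale -[RHS]cls_padd.
by apply/clsP=> m; rewrite !coeffE mulrDl.
Qed.
HB.instance Definition _ := GRing.Zmodule_isLmodule.Build R (salg R)
  sscaleA sscale1 sscaleDr sscaleDl.
Fact sscaleAl (a : R) x y : a *: (x * y) = (a *: x) * y.
Proof.
elim/cls_ind: x => p; elim/cls_ind: y => q.
rewrite -[cls p * _]cls_pmul -[LHS]cls_pscale -[a *: _]cls_pscale -[RHS]cls_pmul.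
apply/clsP=> m; rewrite coeff_scale !coeff_mul mulr_sumr big_map; apply: eq_bigr => b _.
by rewrite mulr_sumr; apply: eq_bigr => c _ /=; case: ifP => _; rewrite ?mulr0 // mulrCA !mulrA.
Qed.
HB.instance Definition _ := GRing.Lmodule_isLalgebra.Build R (salg R) sscaleAl.
Fact sscaleAr (a : R) x y : a *: (x * y) = x * (a *: y).
Proof.
elim/cls_ind: x => p; elim/cls_ind: y => q.
rewrite -[cls p * _]cls_pmul -[LHS]cls_pscale -[a *: _]cls_pscale -[RHS]cls_pmul.
apply/clsP=> m; rewrite coeff_scale !coeff_mul mulr_sumr; apply: eq_bigr => b _.
rewrite mulr_sumr big_map; apply: eq_bigr => c _ /=; case: ifP => _; rewrite ?mulr0 //.
by rewrite mulrCA; congr (_ * _); rewrite mulrCA.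
Qed.
HB.instance Definition _ := GRing.Lalgebra_isAlgebra.Build R (salg R) sscaleAr.

Lemma clsD p q : cls (padd p q) = cls p + cls q. Proof. exact: cls_padd. Qed.
Lemma clsZ c p : cls (pscale c p) = c *: cls p. Proof. exact: cls_pscale. Qed.
Lemma clsM p q : cls (pmul p q) = cls p * cls q. Proof. exact: cls_pmul. Qed.
Lemma cls0 : cls [::] = 0 :> salg R. Proof. by []. Qed.
Lemma clsB p q : cls (psub p q) = cls p - cls q.
Proof. by rewrite clsD clsZ scaleN1r. Qed.

Definition X (v : var) : salg R := cls (pv R v).
Definition wd (s : seq var) : salg R := \prod_(v <- s) X v.

Lemma cls_word s : cls [:: (1, s)] = wd s.
Proof.
rewrite /wd; elim: s => [|v s IH]; first by rewrite big_nil.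
by rewrite big_cons -IH -clsM /pmul /= mulr1.
Qed.
Lemma cls_cons c s p : cls ((c, s) :: p) = c *: wd s + cls p.
Proof.
rewrite -[_ :: p]/(padd [:: (c, s)] p) clsD -cls_word -clsZ.
by congr (cls _ + _); rewrite /pscale /= mulr1.
Qed.
Lemma cls_pc c : cls (pc c) = c%:A :> salg R.
Proof. by rewrite /pc cls_cons /wd big_nil addr0. Qed.

Lemma wd_cons v s : wd (v :: s) = X v * wd s. Proof. exact: big_cons. Qed.
Lemma wd_nil : wd [::] = 1. Proof. exact: big_nil. Qed.
Lemma wd_cat s t : wd (s ++ t) = wd s * wd t. Proof. exact: big_cat. Qed.

Lemma wd_supersym : supersym wd.
Proof.
move=> s1 a b s2; rewrite -!cls_word -clsZ; apply/clsP=> m; rewrite coeff_scale.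
rewrite /coeff !big_seq1 /= (nf_perm (perm_swap s1 a b s2)) sgnw_swap.
by case: ifP => _; rewrite ?mulr0 // !mulr1.
Qed.

Lemma XX a b : X a * X b = (-1) ^+ (odd_var a && odd_var b) *: (X b * X a).
Proof. by have := wd_supersym [::] a b [::]; rewrite /= !wd_cons wd_nil !mulr1. Qed.

Lemma cls_sum p : cls p = \sum_(tm <- p) tm.1 *: wd tm.2.
Proof. by elim: p => [|[c s] p IH]; rewrite ?big_nil // big_cons cls_cons IH. Qed.

(* Only when G is [supersym] does [Lin G] extend G (see [Lin_wd]). *)
Definition Lin (V : lmodType R) (G : seq var -> V) (x : salg R) : V :=
  let p := rep x in
  \sum_(m <- undup (map (fun tm => nf tm.2) p)) coeff p m *: G m.

Lemma LinE (V : lmodType R) (G : seq var -> V) ms x : uniq ms ->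
  (forall m, m \notin ms -> coeff (rep x) m = 0) ->
  Lin G x = \sum_(m <- ms) coeff (rep x) m *: G m.
Proof.
move=> ums H; rewrite /Lin; set l := undup _.
have Hl m : m \notin l -> coeff (rep x) m = 0.
  rewrite mem_undup => nm; rewrite /coeff big1_seq // => tm /= tmx.
  by case: eqP => // e; case/negP: nm; rewrite -e; apply/mapP; exists tm.
have aux (l1 l2 : seq (seq var)) : uniq l1 -> uniq l2 ->
   (forall m, m \notin l2 -> coeff (rep x) m = 0) ->
   \sum_(m <- l1) coeff (rep x) m *: G m = \sum_(m <- l1 | m \in l2) coeff (rep x) m *: G m.
  move=> u1 u2 H2; rewrite [LHS](bigID (mem l2)) /= [X in _ + X]big1 ?addr0 //.
  by move=> m nm; rewrite H2 ?scale0r.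
rewrite (aux l ms) ?undup_uniq // [RHS](aux ms l) ?undup_uniq //.
rewrite -big_filter -[RHS]big_filter; apply: perm_big; apply: uniq_perm.
- by rewrite filter_uniq ?undup_uniq.
- by rewrite filter_uniq.
- by move=> m; rewrite !mem_filter andbC.
Qed.

Lemma coeff_notin p m : m \notin map (fun tm => nf tm.2) p -> coeff p m = 0.
Proof.
move=> nm; rewrite /coeff big1_seq // => tm /= tmx.
by case: eqP => // e; case/negP: nm; rewrite -e; apply/mapP; exists tm.
Qed.

Fact Lin_linear (V : lmodType R) (G : seq var -> V) : linear (Lin G).
Proof.
move=> c x y; pose ms := undup (map (fun tm => nf tm.2) (padd (rep x) (rep y))).
have xy m : coeff (rep (c *: x + y)) m = c * coeff (rep x) m + coeff (rep y) m.
  have -> : c *: x + y = cls (padd (pscale c (rep x)) (rep y)) by rewrite clsD clsZ !repK.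
  by rewrite rep_cls !coeffE.
have nx m : m \notin ms -> coeff (rep x) m = 0.
  by move=> nm; apply: coeff_notin; apply: contra nm; rewrite mem_undup map_cat mem_cat => ->.
have ny m : m \notin ms -> coeff (rep y) m = 0.
  by move=> nm; apply: coeff_notin; apply: contra nm; rewrite mem_undup map_cat mem_cat orbC => ->.
rewrite !(@LinE _ _ ms) ?undup_uniq //; last by move=> m nm; rewrite xy nx // ny // mulr0 addr0.
rewrite scaler_sumr -big_split; apply: eq_bigr => m _.
by rewrite xy scalerDl scalerA.
Qed.
HB.instance Definition _ (V : lmodType R) (G : seq var -> V) :=
  GRing.isLinear.Build R (salg R) V *:%R (Lin G) (Lin_linear G).

Lemma Lin_cls (V : lmodType R) (G : seq var -> V) p : supersym G -> Lin G (cls p) = lin G p.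
Proof.
move=> HG; have e : peq (rep (cls p)) p by exact: rep_cls.
rewrite -(lin_peq HG e) (lin_coeff HG (undup_uniq (map (fun tm => nf tm.2) (rep (cls p))))) //.
by move=> m; rewrite mem_undup.
Qed.
Lemma Lin_wd (V : lmodType R) (G : seq var -> V) s : supersym G -> Lin G (wd s) = G s.
Proof. by move=> HG; rewrite -cls_word Lin_cls // /lin big_seq1 scale1r. Qed.

Lemma salg_ind (P : salg R -> Prop) : P 0 ->
  (forall c s x, P x -> P (c *: wd s + x)) -> forall x, P x.
Proof.
move=> h0 hD; elim/cls_ind=> p; elim: p => [|[c s] p IH] //.
by rewrite cls_cons; apply: hD.
Qed.

Lemma linear_eq (V : lmodType R) (F G : {linear salg R -> V}) :
  (forall s, F (wd s) = G (wd s)) -> F =1 G.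
Proof.
move=> h; elim/salg_ind=> [|c s x IH]; first by rewrite !linear0.
by rewrite !linearP IH h.
Qed.
End Algebra.

(** * Degrees, substitutions, derivations *)

Section Degree.
Variable R : numFieldType.
Implicit Types (p q r : spoly R) (x y z : salg R).
Local Notation X := (X R).
Local Notation wd := (wd R).

(** One notion for the odd degree and for the degree in the letters u. It asks for some
    representative, because words that cancel or repeat an odd letter may have any degree. *)
Definition hdeg (P : pred var) (n : nat) x :=
  exists2 p, x = cls p & all (fun tm => count P tm.2 == n) p.

Lemma hdeg_wd (P : pred var) s : hdeg P (count P s) (wd s).
Proof. by exists [:: (1, s)]; rewrite ?cls_word //= eqxx. Qed.
Lemma hdegX (P : pred var) v : hdeg P (P v) (X v).
Proof. by have := hdeg_wd P [:: v]; rewrite wd_cons wd_nil mulr1 /= addn0. Qed.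
Lemma hdeg0 P n : hdeg P n 0. Proof. by exists [::]. Qed.
Lemma hdegD P n x y : hdeg P n x -> hdeg P n y -> hdeg P n (x + y).
Proof. by case=> p -> hp [q -> hq]; exists (padd p q); rewrite ?clsD // /padd all_cat hp. Qed.
Lemma hdegZ P n c x : hdeg P n x -> hdeg P n (c *: x).
Proof. by case=> p -> hp; exists (pscale c p); rewrite ?clsZ // /pscale all_map. Qed.
Lemma hdegN P n x : hdeg P n x -> hdeg P n (- x).
Proof. by rewrite -scaleN1r; exact: hdegZ. Qed.
Lemma hdegB P n x y : hdeg P n x -> hdeg P n y -> hdeg P n (x - y).
Proof. by move=> hx hy; apply: hdegD => //; apply: hdegN. Qed.
Lemma hdeg1 P : hdeg P 0 1.
Proof. by have := hdeg_wd P [::]; rewrite wd_nil. Qed.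
Lemma hdeg_ind P n (Q : salg R -> Prop) : Q 0 ->
  (forall c s x, count P s = n -> Q x -> Q (c *: wd s + x)) ->
  forall x, hdeg P n x -> Q x.
Proof.
move=> h0 hD x [p -> ]; elim: p => [|[c s] p IH] //= /andP[/eqP hs hp].
by rewrite cls_cons; apply: hD => //; exact: IH.
Qed.
Lemma hdegM P m n x y : hdeg P m x -> hdeg P n y -> hdeg P (m + n) (x * y).
Proof.
move=> hx hy; elim/hdeg_ind: hx => [|c s {}x hs IH]; first by rewrite mul0r; exact: hdeg0.
rewrite mulrDl; apply: hdegD => //; rewrite -scalerAl; apply: hdegZ.
elim/hdeg_ind: hy => [|c' t z ht IH2]; first by rewrite mulr0; exact: hdeg0.
rewrite mulrDr; apply: hdegD => //; rewrite -scalerAr; apply: hdegZ.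
by rewrite -wd_cat -hs -ht -count_cat; exact: hdeg_wd.
Qed.
Notation odeg := (hdeg odd_var).
Lemma odegM_eq k m n x y : odeg m x -> odeg n y -> (m + n)%N = k -> odeg k (x * y).
Proof. by move=> hx hy <-; exact: hdegM. Qed.

Lemma XwdC v s : X v * wd s = (-1) ^+ (odd_var v && odd (count odd_var s)) *: (wd s * X v).
Proof.
elim: s => [|a s IH]; first by rewrite wd_nil mulr1 mul1r andbF scale1r.
rewrite wd_cons mulrA XX -scalerAl -[X a * X v * _]mulrA IH -scalerAr scalerA mulrA; congr (_ *: _).
by rewrite /= oddD oddb; case: (odd_var v); case: (odd_var a); case: (odd _);
  rewrite /= ?expr1 ?expr0 ?mulr1 ?mul1r ?mulrNN ?mulr1.
Qed.
Lemma wdC s t : wd s * wd t =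
  (-1) ^+ (odd (count odd_var s) && odd (count odd_var t)) *: (wd t * wd s).
Proof.
elim: s => [|a s IH]; first by rewrite wd_nil mulr1 mul1r scale1r.
rewrite wd_cons -[LHS]mulrA IH -scalerAr [X a * (_ * _)]mulrA XwdC -scalerAl scalerA -[wd t * X a * wd s]mulrA; congr (_ *: _).
by rewrite /= oddD oddb; case: (odd_var a); case: (odd _); case: (odd _);
  rewrite /= ?expr1 ?expr0 ?mulr1 ?mul1r ?mulrNN ?mulr1.
Qed.
Lemma odegC m n x y : odeg m x -> odeg n y -> x * y = (-1) ^+ (odd m && odd n) *: (y * x).
Proof.
move=> hx hy; elim/hdeg_ind: hx => [|c s {}x hs IH]; first by rewrite mul0r mulr0 scaler0.
rewrite mulrDl mulrDr scalerDr IH; congr (_ + _).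
rewrite -scalerAl -scalerAr scalerA mulrC -scalerA; congr (_ *: _).
elim/hdeg_ind: hy => [|c' t z ht IH2]; first by rewrite mul0r mulr0 scaler0.
rewrite mulrDl mulrDr scalerDr IH2; congr (_ + _).
rewrite -scalerAl -scalerAr scalerA mulrC -scalerA; congr (_ *: _).
by rewrite wdC hs ht.
Qed.
Lemma odeg0C n x y : odeg 0 x -> odeg n y -> x * y = y * x.
Proof. by move=> hx hy; rewrite (odegC hx hy) scale1r. Qed.
Lemma odeg0_central x y : odeg 0 x -> x * y = y * x.
Proof.
move=> hx; elim/salg_ind: y => [|c s y IH]; first by rewrite mul0r mulr0.
by rewrite mulrDl mulrDr IH -scalerAl -scalerAr (odeg0C hx (hdeg_wd odd_var s)).
Qed.

Lemma linear_ext (V : lmodType R) (F G : {linear salg R -> V}) : F 1 = G 1 ->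
  (forall v x, F x = G x -> F (X v * x) = G (X v * x)) -> F =1 G.
Proof.
move=> h1 hX; apply: linear_eq => s; elim: s => [|v s IH]; first by rewrite wd_nil.
by rewrite wd_cons; apply: hX.
Qed.

Definition hspar (P : pred var) (a : var -> salg R) := forall v, hdeg P (P v) (a v).
Notation spar := (hspar odd_var).
(** The substitution of [a v] for each letter v; it is an algebra homomorphism as soon as [a]
    preserves parity. *)
Definition phi (a : var -> salg R) : salg R -> salg R := Lin (fun s => \prod_(v <- s) a v).
HB.instance Definition _ a := GRing.Linear.on (phi a).
Lemma phiP a c x y : phi a (c *: x + y) = c *: phi a x + phi a y. Proof. exact: linearP. Qed.
Lemma phi_0 a : phi a 0 = 0. Proof. exact: linear0. Qed.
Lemma phiD a x y : phi a (x + y) = phi a x + phi a y. Proof. exact: linearD. Qed.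
Lemma phiB a x y : phi a (x - y) = phi a x - phi a y. Proof. exact: linearB. Qed.
Lemma phiZ a c x : phi a (c *: x) = c *: phi a x. Proof. exact: linearZ. Qed.

Lemma phi_supersym a : spar a -> supersym (fun s => \prod_(v <- s) a v).
Proof.
move=> ha s1 b c s2; rewrite !big_cat !big_cons /= !mulrA scalerAl; congr (_ * _).
rewrite -!mulrA scalerAr; congr (_ * _).
by rewrite (odegC (ha b) (ha c)); case: (odd_var b); case: (odd_var c).
Qed.
Lemma phi_wd a s : spar a -> phi a (wd s) = \prod_(v <- s) a v.
Proof. by move=> ha; rewrite /phi Lin_wd //; exact: phi_supersym. Qed.
Lemma phiX a v : spar a -> phi a (X v) = a v.
Proof. by move=> ha; have := phi_wd [:: v] ha; rewrite wd_cons wd_nil mulr1 big_seq1. Qed.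
Lemma phi1 a : spar a -> phi a 1 = 1.
Proof. by move=> ha; have := phi_wd [::] ha; rewrite wd_nil big_nil. Qed.
Lemma phiM a x y : spar a -> phi a (x * y) = phi a x * phi a y.
Proof.
move=> ha; elim/salg_ind: x => [|c s x IH]; first by rewrite mul0r phi_0 mul0r.
rewrite mulrDl -scalerAl !phiP mulrDl -scalerAl IH; congr (_ *: _ + _).
clear IH; elim/salg_ind: y => [|c' t y IH2]; first by rewrite mulr0 phi_0 mulr0.
rewrite mulrDr -scalerAr !phiP mulrDr -scalerAr IH2; congr (_ *: _ + _).
by rewrite -wd_cat !phi_wd // big_cat.
Qed.
Lemma phi_hdeg P a n x : spar a -> hspar P a -> hdeg P n x -> hdeg P n (phi a x).
Proof.
move=> ha ha'; elim/hdeg_ind=> [|c s {}x hs IH]; first by rewrite phi_0; exact: hdeg0.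
rewrite phiP; apply: hdegD => //; apply: hdegZ; rewrite phi_wd // -hs.
elim: s {hs} => [|v s IH2]; first by rewrite big_nil; exact: hdeg1.
by rewrite big_cons; apply: hdegM.
Qed.

(** The value [f v] behaves like an element of parity [odd_var v (+) od]. This commutation rule is
    what the Leibniz extension of [f] needs in order to respect swaps of letters. *)
Definition fsuper (od : bool) (f : var -> spoly R) := forall v w,
  cls (f v) * X w = (-1) ^+ ((odd_var v (+) od) && odd_var w) *: (X w * cls (f v)).
Definition Der od (f : var -> spoly R) : salg R -> salg R := Lin (fun s => cls (der_word od f s)).
HB.instance Definition _ od f := GRing.Linear.on (Der od f).
Lemma DerP od f c x y : Der od f (c *: x + y) = c *: Der od f x + Der od f y. Proof. exact: linearP. Qed.
Lemma Der_0 od f : Der od f 0 = 0. Proof. exact: linear0. Qed.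
Lemma DerD od f x y : Der od f (x + y) = Der od f x + Der od f y. Proof. exact: linearD. Qed.
Lemma DerZ od f c x : Der od f (c *: x) = c *: Der od f x. Proof. exact: linearZ. Qed.

Lemma cls_der_word od f v s : cls (der_word od f (v :: s)) =
  cls (f v) * wd s + (-1) ^+ (od && odd_var v) *: (X v * cls (der_word od f s)).
Proof.
rewrite /= clsD clsZ !clsM cls_word; congr (_ + _ *: _).
by case: (_ && _).
Qed.
Lemma Der_supersym od f : fsuper od f -> supersym (fun s => cls (der_word od f s)).
Proof.
move=> hf; elim=> [|v s1 IH] a b s2 /=; last first.
  rewrite -/(der_word od f _) !cls_der_word IH wd_supersym scalerDr -!scalerAr; congr (_ + _).
  by rewrite !scalerA mulrC.
rewrite !cls_der_word !wd_cons !mulrA !mulrDr !scalerDr !mulrA (hf a b) (hf b a).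
rewrite -!scalerAr -!scalerAl !scalerA !mulrA XX -!scalerAl !scalerA.
rewrite addrCA !addrA; congr (_ *: _ + _ *: _ + _ *: _);
by case: (od); case: (odd_var a); case: (odd_var b);
  rewrite /= ?expr1 ?expr0 ?mulr1 ?mul1r ?mulrNN ?mulr1.
Qed.
Lemma Der_cls od f p : fsuper od f -> Der od f (cls p) = cls (der od f p).
Proof.
move=> hf; rewrite /Der Lin_cls; last exact: Der_supersym.
rewrite /lin /der; elim: p => [|tm p IH]; first by rewrite big_nil.
by rewrite big_cons /= -/(padd _ _) clsD clsZ IH.
Qed.
Lemma Der_Xmul od f v x : fsuper od f -> Der od f (X v * x) =
  cls (f v) * x + (-1) ^+ (od && odd_var v) *: (X v * Der od f x).
Proof.
move=> hf; elim/salg_ind: x => [|c s x IH]; first by rewrite mulr0 Der_0 !mulr0 scaler0 addr0.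
rewrite DerP !mulrDr !scalerDr -!scalerAr DerP IH -wd_cons.
rewrite /Der !Lin_wd; try exact: Der_supersym.
rewrite cls_der_word scalerDr !addrA; congr (_ + _).
by rewrite -!addrA; congr (_ + _); rewrite addrC; congr (_ + _); rewrite !scalerA mulrC.
Qed.
Lemma Der1 od f : fsuper od f -> Der od f 1 = 0.
Proof. by move=> hf; rewrite -wd_nil /Der Lin_wd //; exact: Der_supersym. Qed.
Lemma DerX od f v : fsuper od f -> Der od f (X v) = cls (f v).
Proof. by move=> hf; rewrite -[X v]mulr1 Der_Xmul // Der1 // mulr0 scaler0 addr0 mulr1. Qed.

Lemma fsuper_even f : spar (fun v => cls (f v)) -> fsuper false f.
Proof.
move=> hf v w; rewrite (odegC (hf v) (hdegX odd_var w)) addbF.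
by case: (odd_var v); case: (odd_var w).
Qed.
Lemma DerM f x y : fsuper false f ->
  Der false f (x * y) = Der false f x * y + x * Der false f y.
Proof.
move=> hf; elim/salg_ind: x => [|c s x IH]; first by rewrite !(mul0r, Der_0) addr0.
rewrite mulrDl !DerD IH -!scalerAl !DerZ !mulrDl -!scalerAl.
rewrite addrACA -scalerDr; congr (_ *: _ + _).
elim: s => [|v s IH2]; first by rewrite wd_nil Der1 // !mul1r mul0r add0r.
rewrite !wd_cons -!mulrA !Der_Xmul // !expr0 !scale1r IH2.
by rewrite !mulrDl !mulrDr !mulrA addrA.
Qed.
Lemma Der_hdeg P f n x : fsuper false f -> hspar P (fun v => cls (f v)) ->
  hdeg P n x -> hdeg P n (Der false f x).
Proof.
move=> hs0 hf; elim/hdeg_ind=> [|c s {}x hs IH]; first by rewrite Der_0; exact: hdeg0.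
rewrite DerP; apply: hdegD => //; apply: hdegZ; rewrite -hs.
elim: s {hs} => [|v s IH2]; first by rewrite wd_nil Der1 //; exact: hdeg0.
rewrite wd_cons Der_Xmul //.
rewrite expr0 scale1r /=; apply: hdegD; apply: hdegM => //; [exact: hdeg_wd | exact: hdegX].
Qed.

Lemma Dvar_hspar P d : (forall s t, P (VU s) = P (VU t)) -> (forall s t, P (VQ s) = P (VQ t)) ->
  (forall s t, P (VW s) = P (VW t)) -> ~~ P Vt -> ~~ P Vx -> ~~ P Vy ->
  hspar P (fun v => cls (Dvar R d v)).
Proof.
move=> hU hQ hW /negbTE ht /negbTE hx /negbTE hy.
case=> [| | |s|s|s] /=; rewrite ?ht ?hx ?hy;
  try (by case: ifP => _; rewrite ?cls_pc; [apply: hdegZ; exact: hdeg1 | exact: hdeg0]).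
- by rewrite (hU s (shift d s)); exact: (hdegX P (VU _)).
- by rewrite (hQ s (shift d s)); exact: (hdegX P (VQ _)).
- by rewrite (hW s (shift d s)); exact: (hdegX P (VW _)).
Qed.
Definition D (d : nat) : salg R -> salg R := Der false (Dvar R d).
HB.instance Definition _ d := GRing.Linear.on (D d).
Lemma DP d c x y : D d (c *: x + y) = c *: D d x + D d y. Proof. exact: linearP. Qed.
Lemma D_0 d : D d 0 = 0. Proof. exact: linear0. Qed.
Lemma DD d x y : D d (x + y) = D d x + D d y. Proof. exact: linearD. Qed.
Lemma DB d x y : D d (x - y) = D d x - D d y. Proof. exact: linearB. Qed.
Lemma DZ d c x : D d (c *: x) = c *: D d x. Proof. exact: linearZ. Qed.
Lemma Dsuper d : fsuper false (Dvar R d). Proof. by apply: fsuper_even; exact: Dvar_hspar. Qed.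
Lemma DM d x y : D d (x * y) = D d x * y + x * D d y.
Proof. exact: DerM (Dsuper d). Qed.
Lemma DX d v : D d (X v) = cls (Dvar R d v). Proof. exact: DerX (Dsuper d). Qed.
Lemma D1 d : D d 1 = 0. Proof. exact: Der1 (Dsuper d). Qed.
Lemma D_odeg d n x : odeg n x -> odeg n (D d x).
Proof. by apply: Der_hdeg; [exact: Dsuper | exact: Dvar_hspar]. Qed.
Lemma cls_TD d p : cls (TD d p) = D d (cls p).
Proof. by rewrite /D Der_cls //; exact: Dsuper. Qed.

(** The commutator of two even derivations is a derivation, so its vanishing can be checked on
    letters. *)
Lemma Der_comm f g : fsuper false f -> fsuper false g ->
  (forall v, Der false f (cls (g v)) = Der false g (cls (f v))) ->
  forall x, Der false f (Der false g x) = Der false g (Der false f x).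
Proof.
move=> hf hg h; apply: (@linear_ext _ (Der false f \o Der false g) (Der false g \o Der false f)) => /=.
  by rewrite !Der1 // !Der_0.
move=> v x IH; rewrite !Der_Xmul // !expr0 !scale1r !DerD !DerM // !DerX // h IH.
by rewrite -!addrA; congr (_ + _); rewrite addrA [X in X + _]addrC -addrA.
Qed.
Lemma D_comm d e x : D d (D e x) = D e (D d x).
Proof.
apply: Der_comm; try exact: Dsuper.
case=> [| | |[[k i] j]|[[k i] j]|[[k i] j]] /=;
  try (by do 2 (case: ifP => _); rewrite ?cls_pc ?cls0 ?DerZ ?Der_0 //= ?Der1 ?scaler0 //; exact: Dsuper).
- by rewrite !(DerX _ (Dsuper _)); case: d => [|[|d]]; case: e => [|[|e]].
- by rewrite !(DerX _ (Dsuper _)); case: d => [|[|d]]; case: e => [|[|e]].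
- by rewrite !(DerX _ (Dsuper _)); case: d => [|[|d]]; case: e => [|[|e]].
Qed.

Definition Dm (s : midx) x := iter s.1.1 (D 0) (iter s.1.2 (D 1) (iter s.2 (D 2) x)).
Fact iterD_linear d n : linear (iter n (D d)).
Proof. by move=> c x y; elim: n => //= n ->; rewrite DP. Qed.
Fact Dm_linear s : linear (Dm s).
Proof. by move=> c x y; rewrite /Dm !iterD_linear. Qed.
HB.instance Definition _ s := GRing.isLinear.Build R (salg R) (salg R) *:%R (Dm s) (Dm_linear s).
Lemma Dm_0 s : Dm s 0 = 0. Proof. exact: linear0. Qed.
Lemma DmB s x y : Dm s (x - y) = Dm s x - Dm s y. Proof. exact: linearB. Qed.
Lemma cls_Dms s p : cls (Dms s p) = Dm s (cls p).
Proof.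
rewrite /Dms /Dm; have it d n q : cls (iter n (TD d) q) = iter n (D d) (cls q).
  by elim: n => //= n <-; rewrite cls_TD.
by rewrite !it.
Qed.
Lemma iterD_comm d e n x : D d (iter n (D e) x) = iter n (D e) (D d x).
Proof. by elim: n => //= n <-; rewrite D_comm. Qed.
Lemma D_Dm d s x : (d < 3)%N -> D d (Dm s x) = Dm (shift d s) x.
Proof.
case: s => [[k i] j]; case: d => [|[|[|]]] //= _; rewrite /Dm /= ?iterD_comm //.
Qed.
Lemma Dm_D d s x : (d < 3)%N -> Dm s (D d x) = Dm (shift d s) x.
Proof. by move=> hd; rewrite -D_Dm // /Dm !iterD_comm. Qed.
Lemma Dm_odeg s n x : odeg n x -> odeg n (Dm s x).
Proof.
have it d m y : odeg n y -> odeg n (iter m (D d) y) by move=> h; elim: m => //= m; exact: D_odeg.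
by move=> h; rewrite /Dm; apply: (it); apply: (it); apply: (it).
Qed.
Lemma Dm_XU s : Dm s (X (VU (0,0,0)%N)) = X (VU s).
Proof.
case: s => [[k i] j]; rewrite /Dm /=.
have -> : iter j (D 2) (X (VU (0,0,0)%N)) = X (VU (0,0,j)%N) by elim: j => //= j ->; rewrite DX.
have -> : iter i (D 1) (X (VU (0,0,j)%N)) = X (VU (0,i,j)%N) by elim: i => //= i ->; rewrite DX.
by elim: k => //= k ->; rewrite DX.
Qed.
Lemma Dm_XQ s : Dm s (X (VQ (0,0,0)%N)) = X (VQ s).
Proof.
case: s => [[k i] j]; rewrite /Dm /=.
have -> : iter j (D 2) (X (VQ (0,0,0)%N)) = X (VQ (0,0,j)%N) by elim: j => //= j ->; rewrite DX.
have -> : iter i (D 1) (X (VQ (0,0,j)%N)) = X (VQ (0,i,j)%N) by elim: i => //= i ->; rewrite DX.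
by elim: k => //= k ->; rewrite DX.
Qed.
Lemma Dm_XW s : Dm s (X (VW (0,0,0)%N)) = X (VW s).
Proof.
case: s => [[k i] j]; rewrite /Dm /=.
have -> : iter j (D 2) (X (VW (0,0,0)%N)) = X (VW (0,0,j)%N) by elim: j => //= j ->; rewrite DX.
have -> : iter i (D 1) (X (VW (0,0,j)%N)) = X (VW (0,i,j)%N) by elim: i => //= i ->; rewrite DX.
by elim: k => //= k ->; rewrite DX.
Qed.
End Degree.
Notation odeg := (hdeg odd_var).
Notation spar := (hspar odd_var).

(** * Decision of linear and superpolynomial identities *)

Section ModuleNormal.
Variables (R : comNzRingType) (V : lmodType R).
Inductive mexp := MVar of nat | MZero | MAdd of mexp & mexp | MOpp of mexp | MScale of R & mexp.
Fixpoint meval (env : seq V) (t : mexp) : V :=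
  match t with
  | MVar i => nth 0 env i | MZero => 0
  | MAdd t1 t2 => meval env t1 + meval env t2
  | MOpp t1 => - meval env t1 | MScale c t1 => c *: meval env t1 end.
Fixpoint mcoef (i : nat) (t : mexp) : R :=
  match t with
  | MVar j => if eqn i j then 1 else 0 | MZero => 0
  | MAdd t1 t2 => mcoef i t1 + mcoef i t2
  | MOpp t1 => - mcoef i t1 | MScale c t1 => c * mcoef i t1 end.
Fixpoint mall (n : nat) (t : mexp) : Prop :=
  match n with 0%N => True | n'.+1 => mcoef n' t = 0 /\ mall n' t end.
Lemma mevalE env t : meval env t = \sum_(i < size env) mcoef i t *: nth 0 env i.
Proof.
elim: t => [j||t1 IH1 t2 IH2|t IH|c t IH] /=.
- case: (ltnP j (size env)) => hj; last first.
    rewrite nth_default // big1 // => i _; case: eqnP => [e|_]; last by rewrite scale0r.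
    by have := ltn_ord i; rewrite e; lia.
  rewrite (bigD1 (Ordinal hj)) //= eqnE eqxx scale1r big1 ?addr0 // => i ij.
  case: eqP => [e|_]; last by rewrite scale0r.
  by case/negP: ij; apply/eqP; apply: ord_inj.
- by rewrite big1 // => i _; rewrite scale0r.
- by rewrite IH1 IH2 -big_split; apply: eq_bigr => i _; rewrite scalerDl.
- by rewrite IH -sumrN; apply: eq_bigr => i _; rewrite scaleNr.
- by rewrite IH scaler_sumr; apply: eq_bigr => i _; rewrite scalerA.
Qed.
(** A linear identity between opaque atoms is reduced to one scalar identity per atom, which
    [linear_ring] hands to [ring] or [field]. *)
Lemma meval0 env t : mall (size env) t -> meval env t = 0.
Proof.
rewrite mevalE => h; apply: big1 => i _.
suff -> : mcoef i t = 0 by rewrite scale0r.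
elim: (size env) (i : nat) (ltn_ord i) h => // n IH j; rewrite ltnS leq_eqVlt => /orP[/eqP->|hj] [h1 h2] //.
exact: IH.
Qed.
Lemma meval_eq (x y : V) : x - y = 0 -> x = y.
Proof. by move/eqP; rewrite subr_eq0 => /eqP. Qed.
End ModuleNormal.

(* Products are compared up to the choice of the ring structure. *)
Ltac m_eq a b := match a with
  | b => constr:(true)
  | @GRing.one _ => lazymatch b with @GRing.one _ => constr:(true) | _ => constr:(false) end
  | @GRing.mul _ ?a1 ?a2 => lazymatch b with
     | @GRing.mul _ ?b1 ?b2 => let e := m_eq a1 b1 in
        lazymatch e with true => m_eq a2 b2 | _ => constr:(false) end
     | _ => constr:(false) end
  | _ => constr:(false) end.
Ltac m_mem a l := lazymatch l with
  | nil => constr:(false)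
  | cons ?b ?l' => let e := m_eq a b in
     lazymatch e with true => constr:(true) | _ => m_mem a l' end end.
Ltac m_add a l := let e := m_mem a l in
  lazymatch e with true => l | _ => constr:(cons a l) end.
Ltac m_idx a l := lazymatch l with
  | cons ?b ?l' => let e := m_eq a b in
     lazymatch e with true => constr:(0%N) | _ => let n := m_idx a l' in constr:(S n) end end.

Ltac m_atoms t l := lazymatch t with
  | @Algebra.zero _ => l
  | @Algebra.add _ ?a ?b => let l1 := m_atoms a l in m_atoms b l1
  | @Algebra.opp _ ?a => m_atoms a l
  | @GRing.scale _ _ _ ?a => m_atoms a l
  | _ => m_add t l end.
Ltac m_reify R t l := lazymatch t with
  | @Algebra.zero _ => constr:(@MZero R)
  | @Algebra.add _ ?a ?b => let x := m_reify R a l in let y := m_reify R b l in constr:(@MAdd R x y)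
  | @Algebra.opp _ ?a => let x := m_reify R a l in constr:(@MOpp R x)
  | @GRing.scale _ _ ?c ?a => let x := m_reify R a l in constr:(@MScale R c x)
  | _ => let n := m_idx t l in constr:(@MVar R n) end.
Ltac linear_ring R V :=
  apply: meval_eq;
  lazymatch goal with |- ?t = _ =>
    let l := m_atoms t (@nil V) in
    let e := m_reify R t l in
    refine (@meval0 R V l e _); cbv [mall mcoef size eqn]; repeat split; (ring || (field; by rewrite ?pnatr_eq0)) end.

Section SuperNormal.
Variable R : numFieldType.

(* [vcmp] replaces the order of [nf], whose [pickle] codes are too large to be
   computed. *)
Definition vcode (v : var) : seq nat :=
  match v with
  | Vt => [:: 0] | Vx => [:: 1] | Vy => [:: 2]
  | VU (k,i,j) => [:: 3; k; i; j] | VQ (k,i,j) => [:: 4; k; i; j]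
  | VW (k,i,j) => [:: 5; k; i; j] end%N.
Fixpoint ncmp (m n : nat) : comparison :=
  match m, n with
  | 0, 0 => Eq | 0, _.+1 => Lt | _.+1, 0 => Gt | m'.+1, n'.+1 => ncmp m' n' end%N.
Fixpoint lcmp (s t : seq nat) : comparison :=
  match s, t with
  | [::], [::] => Eq | [::], _ :: _ => Lt | _ :: _, [::] => Gt
  | a :: s', b :: t' => match ncmp a b with Eq => lcmp s' t' | r => r end end.
Definition vcmp v w := lcmp (vcode v) (vcode w).
Fixpoint wcmp (s t : seq var) : bool :=
  match s, t with
  | [::], [::] => true
  | a :: s', b :: t' => match vcmp a b with Eq => wcmp s' t' | _ => false end
  | _, _ => false end.

Lemma vcmp_eq v w : vcmp v w = Eq -> v = w.
Proof.
have ne m n : ncmp m n = Eq -> m = n by elim: m n => [|m IH] [|n] //= /IH ->.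
have le s t : lcmp s t = Eq -> s = t.
  elim: s t => [|a s IH] [|b t] //=; case e: (ncmp a b) => // /IH ->.
  by rewrite (ne _ _ e).
move=> /le; case: v => [| | |[[k i] j]|[[k i] j]|[[k i] j]];
by case: w => [| | |[[k' i'] j']|[[k' i'] j']|[[k' i'] j']] //= [-> -> ->].
Qed.
Lemma wcmp_eq s t : wcmp s t -> s = t.
Proof.
elim: s t => [|a s IH] [|b t] //=; case e: (vcmp a b) => // /IH ->.
by rewrite (vcmp_eq e).
Qed.

Definition bxor (a b : bool) := if a then (if b then false else true) else b.
Definition band (a b : bool) := if a then b else false.
Fixpoint wins (v : var) (s : seq var) : bool * seq var :=
  match s with
  | [::] => (false, [:: v])
  | w :: s' => match vcmp v w with
    | Gt => let: (b, r) := wins v s' in (bxor (band (odd_var v) (odd_var w)) b, w :: r)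
    | _ => (false, v :: s) end
  end.
Fixpoint wsort (s : seq var) : bool * seq var :=
  match s with
  | [::] => (false, [::])
  | v :: s' => let: (b, r) := wsort s' in let: (b', r') := wins v r in (bxor b b', r')
  end.
Fixpoint wdup (s : seq var) : bool :=
  match s with
  | v :: (w :: _) as s' => if band (odd_var v) (match vcmp v w with Eq => true | _ => false end)
                          then true else wdup s'
  | _ => false end.
Fixpoint addterm (c : R) (s : seq var) (p : spoly R) : spoly R :=
  match p with
  | [::] => [:: (c, s)]
  | (d, t) :: p' => if wcmp s t then (d + c, t) :: p' else (d, t) :: addterm c s p'
  end.
Fixpoint pnorm (p : spoly R) : spoly R :=
  match p with
  | [::] => [::]
  | (c, s) :: p' => let: (b, r) := wsort s in
     if wdup r then pnorm p' else addterm (if b then - c else c) r (pnorm p') end.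
Fixpoint pzero (p : spoly R) : Prop :=
  match p with [::] => True | (c, _) :: p' => c = 0 /\ pzero p' end.

Lemma wins_eq v s : wd R (v :: s) = (-1) ^+ (wins v s).1 *: wd R (wins v s).2.
Proof.
elim: s => [|w s IH] /=; first by rewrite scale1r.
case: (vcmp v w); rewrite ?scale1r //; case e: (wins v s) IH => [b r] /= IH.
rewrite !wd_cons mulrA XX -scalerAl -[X R w * X R v * _]mulrA -[X R v * wd R s]wd_cons IH -scalerAr scalerA; congr (_ *: _).
by rewrite /bxor /band; case: (odd_var v); case: (odd_var w); case: (b);
  rewrite /= ?expr1 ?expr0 ?mulr1 ?mul1r ?mulrNN ?mulr1.
Qed.
Lemma wsort_eq s : wd R s = (-1) ^+ (wsort s).1 *: wd R (wsort s).2.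
Proof.
elim: s => [|v s IH] /=; first by rewrite scale1r.
case e: (wsort s) IH => [b r] /= IH; case e': (wins v r) (wins_eq v r) => [b' r'] /= IH'.
rewrite wd_cons IH -scalerAr -wd_cons IH' scalerA; congr (_ *: _).
by rewrite /bxor; case: (b); case: (b'); rewrite /= ?expr1 ?expr0 ?mulr1 ?mul1r ?mulrNN ?mulr1.
Qed.
Lemma wdup_eq s : wdup s -> wd R s = 0.
Proof.
elim: s => [|v [|w s] IH] //; rewrite wd_cons /= /band.
case ov: (odd_var v); last by move/IH ->; rewrite mulr0.
case e: (vcmp v w); try by move/IH ->; rewrite mulr0.
move=> _; rewrite -(vcmp_eq e) wd_cons mulrA (_ : X R v * X R v = 0) ?mul0r //.
by apply: (@eqN_scale0 R); rewrite {1}XX ov expr1 scaleN1r.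
Qed.
Lemma addterm_eq c s p : cls (addterm c s p) = c *: wd R s + cls p.
Proof.
elim: p => [|[d t] p IH] /=; first by rewrite cls_cons.
case e: (wcmp s t); last by rewrite !cls_cons IH addrCA.
by rewrite (wcmp_eq e) !cls_cons scalerDl addrAC addrC.
Qed.
Lemma pnorm_eq p : cls (pnorm p) = cls p.
Proof.
elim: p => [|[c s] p IH] //=; rewrite cls_cons (wsort_eq s).
case: (wsort s) => b r; case: ifP => [/wdup_eq /= ->|_].
  by rewrite IH !scaler0 add0r.
rewrite addterm_eq IH scalerA; congr (_ *: _ + _).
by case: b; rewrite ?mulr1 // mulrN1.
Qed.
(** Verification by computation for superpolynomials with explicit words: after sorting and
    collecting, only scalar identities remain. [spoly_cbv] evaluates [pnorm] to expose them. *)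
Lemma pnorm0 p : pzero (pnorm p) -> cls p = 0.
Proof.
rewrite -pnorm_eq; elim: (pnorm p) => [|[c s] q IH] //= [-> /IH h].
by rewrite cls_cons h scale0r addr0.
Qed.
Lemma cls_eq_sub (p q : spoly R) : cls (psub p q) = 0 -> cls p = cls q.
Proof. by rewrite clsB => /eqP; rewrite subr_eq0 => /eqP. Qed.
End SuperNormal.

Ltac spoly_cbv :=
  apply: cls_eq_sub; apply: pnorm0;
  cbv [pnorm psub padd pscale pmul pc pv TD der der_word Dvar shift Dms iter
    addterm wcmp vcmp lcmp ncmp vcode wsort wins wdup band bxor odd_var
    cat map flatten foldr allpairs_dep allpairs fst snd andb pzero nat_of_bool eqn eq_op hasDecEq.eq_op
    Equality.class Equality.eqtype_hasDecEq_mixin ssrnat.HB_unnamed_factory_1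
    Datatypes_nat__canonical__eqtype_Equality cst U Q Wn gam];
  repeat split.
Ltac spoly_norm := spoly_cbv; ring.
Ltac spoly_field := spoly_cbv; (ring || (field; by rewrite ?pnatr_eq0)).

(** * Normal forms modulo the differential ideal *)

Section Ideal.
Variable R : numFieldType.
Implicit Types (G : seq (salg R)) (x y : salg R).

Definition didl G x := exists l : seq (salg R * midx * nat),
  x = \sum_(z <- l) z.1.1 * Dm z.1.2 (nth 0 G z.2).

Lemma didl0 G : didl G 0. Proof. by exists [::]; rewrite big_nil. Qed.
Lemma didlD G x y : didl G x -> didl G y -> didl G (x + y).
Proof. by case=> l -> [l' ->]; exists (l ++ l'); rewrite big_cat. Qed.
Lemma didlMl G x y : didl G y -> didl G (x * y).
Proof.
case=> l ->; exists [seq (x * z.1.1, z.1.2, z.2) | z <- l]; rewrite big_map mulr_sumr.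
by apply: eq_bigr => z _; rewrite mulrA.
Qed.
Lemma didlZ G c x : didl G x -> didl G (c *: x).
Proof. by rewrite -mulr_algl; exact: didlMl. Qed.
Lemma didlN G x : didl G x -> didl G (- x).
Proof. by rewrite -scaleN1r; exact: didlZ. Qed.
Lemma didlB G x y : didl G x -> didl G y -> didl G (x - y).
Proof. by move=> hx hy; apply: didlD => //; apply: didlN. Qed.
Lemma didl_gen G s i : didl G (Dm s (nth 0 G i)).
Proof. by exists [:: (1, s, i)]; rewrite big_seq1 mul1r. Qed.
Lemma didl_ind G (P : salg R -> Prop) : P 0 -> (forall x y, P x -> P y -> P (x + y)) ->
  (forall y s i, P (y * Dm s (nth 0 G i))) -> forall x, didl G x -> P x.
Proof.
move=> h0 hD hg x [l ->]; elim: l => [|z l IH]; first by rewrite big_nil.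
by rewrite big_cons; apply: hD.
Qed.
Lemma didl_D G d x : (d < 3)%N -> didl G x -> didl G (D d x).
Proof.
move=> hd; elim/didl_ind => [|y z hy hz|y s i]; first by rewrite D_0; exact: didl0.
  by rewrite DD; exact: didlD.
rewrite DM D_Dm //; apply: didlD; apply: didlMl; exact: didl_gen.
Qed.
Lemma didl_Dm G s x : didl G x -> didl G (Dm s x).
Proof.
move=> h; rewrite /Dm.
have it d n y : (d < 3)%N -> didl G y -> didl G (iter n (D d) y).
  by move=> hd hy; elim: n => //= n; exact: didl_D.
by apply: (it) => //; apply: (it) => //; apply: (it).
Qed.
Definition homog G := forall i, exists n, odeg n (nth 0 G i).
(** [didl] is a left ideal by definition; a homogeneous generator can be carried past any word at
    the cost of a sign, which makes it two-sided. *)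
Lemma didlMr G x y : homog G -> didl G x -> didl G (x * y).
Proof.
move=> hG; elim/didl_ind => [|z z' hz hz'|z s i]; first by rewrite mul0r; exact: didl0.
  by rewrite mulrDl; exact: didlD.
have [n hn] := hG i.
rewrite -mulrA; apply: didlMl; elim/salg_ind: y => [|c t y IH]; first by rewrite mulr0; exact: didl0.
rewrite mulrDr -scalerAr; apply: didlD => //; apply: didlZ.
rewrite (odegC (Dm_odeg s hn) (hdeg_wd R odd_var t)); apply: didlZ; apply: didlMl; exact: didl_gen.
Qed.
Lemma didl_subst G (h : salg R -> salg R) H :
  (forall x y, h (x + y) = h x + h y) -> h 0 = 0 -> (forall x y, h (x * y) = h x * h y) ->
  (forall d x, (d < 3)%N -> h (D d x) = D d (h x)) ->
  (forall i, didl H (h (nth 0 G i))) ->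
  forall x, didl G x -> didl H (h x).
Proof.
move=> hD h0 hM hd hG x; elim/didl_ind => [|y z|y s i]; first by rewrite h0; exact: didl0.
  by rewrite hD; exact: didlD.
rewrite hM; apply: didlMl.
have it d n z : (d < 3)%N -> h (iter n (D d) z) = iter n (D d) (h z).
  by move=> d3; elim: n => //= n <-; rewrite hd.
by rewrite /Dm !it //; apply: didl_Dm.
Qed.

Lemma in_IWE (p : spoly R) : in_IW p <-> didl (map (@cls R) (gensW R)) (cls p).
Proof.
have nE i : nth 0 (map (@cls R) (gensW R)) i = cls (nth [::] (gensW R) i).
  by case: i => [|[|[|[|[|i]]]]].
split=> [[l /clsP ->]|[l e]].
  exists [seq (cls z.1.1, z.1.2, z.2) | z <- l]; rewrite big_map.
  elim: l => [|x l IH]; first by rewrite big_nil.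
  by rewrite big_cons /= -IH -[_ ++ _]/(padd _ _) clsD clsM cls_Dms nE.
exists [seq (rep z.1.1, z.1.2, z.2) | z <- l]; apply/clsP; rewrite e.
elim: l {e} => [|x l IH]; first by rewrite big_nil.
by rewrite big_cons /= -[_ ++ _]/(padd _ _) clsD clsM cls_Dms -nE repK IH.
Qed.
End Ideal.

(* The covering W for the field v with u = a x^2/2 + v, in which the terms of
   degree two in v have been multiplied by e. *)
Section System.
Variables (R : numFieldType) (a e : R).
Local Notation X := (X R).
Local Notation wd := (wd R).

Definition rE : spoly R :=
  [:: (2 * a, [:: VU (0,0,1)%N]); (4 * a, [:: Vx; VU (0,1,1)%N]); (-1, [:: VU (0,3,1)%N]);
      (2 * e, [:: VU (0,0,1)%N; VU (0,2,0)%N]); (4 * e, [:: VU (0,1,0)%N; VU (0,1,1)%N])].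
Definition rT : spoly R :=
  [:: (2 * a, [:: VQ (0,0,1)%N]); (4 * a, [:: Vx; VQ (0,1,1)%N]); (-1, [:: VQ (0,3,1)%N]);
      (2 * e, [:: VU (0,0,1)%N; VQ (0,2,0)%N]); (2 * e, [:: VU (0,2,0)%N; VQ (0,0,1)%N]);
      (4 * e, [:: VU (0,1,0)%N; VQ (0,1,1)%N]); (4 * e, [:: VU (0,1,1)%N; VQ (0,1,0)%N])].
Definition rX : spoly R :=
  [:: (2 * a, [:: Vx; VQ (0,1,0)%N]); (2 * e, [:: VU (0,1,0)%N; VQ (0,1,0)%N])].
Definition rY : spoly R :=
  [:: (1, [:: VQ (1,0,0)%N]); (1, [:: VQ (0,2,1)%N]); (- 2 * a, [:: Vx; VQ (0,0,1)%N]);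
      (- 2 * e, [:: VU (0,1,0)%N; VQ (0,0,1)%N]); (- 2 * e, [:: VU (0,0,1)%N; VQ (0,1,0)%N])].

Definition gE := psub (pv R (VU (1,1,0)%N)) rE.
Definition gT := psub (pv R (VQ (1,1,0)%N)) rT.
Definition gX := psub (pv R (VW (0,1,0)%N)) rX.
Definition gY := psub (pv R (VW (0,0,1)%N)) rY.
(** Three instances occur: [gens 0 1] is W itself, [gens 1 1] is W shifted to the base point x^2/2,
    and [gens 1 0] is the linearization there. *)
Definition gens : seq (salg R) := [:: cls gE; cls gT; cls gX; cls gY].

(** The equations solved for u_tx, q_tx, w_x and w_y. The letters left over are the internal
    coordinates: u and q without mixed t- and x-derivatives, and the pure t-derivatives of w. When w
    carries both x and y, the x-rule takes precedence. *)
Definition rule (v : var) : option (spoly R) :=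
  match v with
  | VU (k.+1, i.+1, j) => Some (Dms (k,i,j) rE)
  | VQ (k.+1, i.+1, j) => Some (Dms (k,i,j) rT)
  | VW (k, i.+1, j) => Some (Dms (k,i,j) rX)
  | VW (k, 0, j.+1) => Some (Dms (k,0,j) rY)
  | _ => None
  end%N.
(** The order in t drops under the rules for u and q. For w two extra units are needed, since w_y is
    replaced by terms that include q_t. *)
Definition rank (v : var) : nat :=
  match v with VU s | VQ s => s.1.1 | VW s => s.1.1.+2 | _ => 0 end%N.

Definition letters_in (P : pred var) (p : spoly R) := all (fun tm => all P tm.2) p.
Lemma letters_in_add P p q : letters_in P p -> letters_in P q -> letters_in P (padd p q).
Proof. by move=> hp hq; rewrite /letters_in /padd all_cat; apply/andP. Qed.
Lemma letters_in_scale P c p : letters_in P p -> letters_in P (pscale c p).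
Proof. by move=> hp; rewrite /letters_in /pscale all_map; apply: sub_all hp. Qed.
Lemma letters_in_mul P p q : letters_in P p -> letters_in P q -> letters_in P (pmul p q).
Proof.
move=> hp hq; apply/allP => _ /allpairsP [[x y] [/= xp yq ->]] /=.
by rewrite all_cat (allP hp x xp) (allP hq y yq).
Qed.
Lemma letters_in_TD (P Q : pred var) d p : subpred P Q ->
  (forall v, P v -> letters_in Q (Dvar R d v)) -> letters_in P p -> letters_in Q (TD d p).
Proof.
move=> PQ hD; rewrite /TD /der; elim: p => [|[c s] p IH] //= /andP[hs hp].
rewrite -[_ ++ _]/(padd _ _); apply: letters_in_add; last exact: IH.
apply: letters_in_scale; elim: s hs => [|v s IH2] //= /andP[hv hs].
apply: letters_in_add.
  apply: letters_in_mul; first exact: hD.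
  by rewrite /letters_in /= andbT; apply: sub_all hs.
apply: letters_in_scale; apply: letters_in_mul; last exact: IH2.
by rewrite /letters_in /= !andbT; exact: PQ.
Qed.
Definition rk_le n v := (rank v <= n)%N.
Lemma rk_TD d n p : letters_in (rk_le n) p -> letters_in (rk_le ((d == 0%N) + n)) (TD d p).
Proof.
apply: letters_in_TD => [v|v]; rewrite /rk_le; first by move=> h; apply: leq_trans h (leq_addl _ _).
case: v => [| | |[[k i] j]|[[k i] j]|[[k i] j]] /= h; try by case: ifP.
all: by rewrite /letters_in /= !andbT /= /rk_le; case: d => [|[|d]] /=; rewrite ?add0n ?add1n ?ltnS.
Qed.
Lemma rk_Dms s n p : letters_in (rk_le n) p -> letters_in (rk_le (s.1.1 + n)) (Dms s p).
Proof.
case: s => [[k i] j] h; rewrite /Dms /=.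
have h2 : letters_in (rk_le n) (iter i (TD 1) (iter j (TD 2) p)).
  by elim: i => [|i IH] /=; [elim: j => //= j; exact: (@rk_TD 2) | exact: (@rk_TD 1)].
by elim: k => //= k; exact: (@rk_TD 0).
Qed.
Lemma rule_rank v p : rule v = Some p -> letters_in (fun w => rank w < rank v)%N p.
Proof.
have sub n m q : (n < m)%N -> letters_in (rk_le n) q -> letters_in (fun w => rank w < m)%N q.
  move=> nm; rewrite /letters_in; apply: sub_all => tm; apply: sub_all => w h.
  exact: leq_ltn_trans h nm.
case: v => [| | |[[[|k] [|i]] j]|[[[|k] [|i]] j]|[[k [|i]] [|j]]] //= [<-].
- by apply: (sub (k + 0)%N); rewrite ?addn0 // -[k in rk_le k]addn0; exact: (@rk_Dms (k,i,j)).
- by apply: (sub (k + 0)%N); rewrite ?addn0 // -[k in rk_le k]addn0; exact: (@rk_Dms (k,i,j)).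
- by apply: (sub (k + 1)%N); first lia; exact: (@rk_Dms (k,0%N,j)).
- by apply: (sub (k + 0)%N); first lia; exact: (@rk_Dms (k,i,0%N)).
- by apply: (sub (k + 0)%N); first lia; exact: (@rk_Dms (k,i,j.+1)).
Qed.

Lemma odeg_expl n (p : spoly R) : all (fun tm => count odd_var tm.2 == n) p -> odeg n (cls p).
Proof. by exists p. Qed.
Lemma rule_odeg v p : rule v = Some p -> odeg (odd_var v) (cls p).
Proof.
case: v => [| | |[[[|k] [|i]] j]|[[[|k] [|i]] j]|[[k [|i]] [|j]]] //= [<-];
by rewrite cls_Dms; apply: Dm_odeg; apply: odeg_expl.
Qed.

Fixpoint tbl n (v : var) : salg R :=
  if n is n'.+1 then
    match rule v with Some p => phi (tbl n') (cls p) | None => X v end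
  else X v.
Lemma tbl_spar n : spar (tbl n).
Proof.
elim: n => [|n IH] v /=; first exact: hdegX.
by case e1: (rule v) => [p|]; [apply: phi_hdeg => //; exact: rule_odeg | exact: hdegX].
Qed.
Lemma phi_cls (T : var -> salg R) p : spar T ->
  phi T (cls p) = \sum_(tm <- p) tm.1 *: \prod_(v <- tm.2) T v.
Proof. by move=> hT; rewrite /phi Lin_cls //; exact: phi_supersym. Qed.
Lemma phi_agree (T T' : var -> salg R) (P : pred var) p : spar T -> spar T' ->
  (forall v, P v -> T v = T' v) -> letters_in P p -> phi T (cls p) = phi T' (cls p).
Proof.
move=> hT hT' h hp; rewrite !phi_cls //; apply: eq_big_seq => tm tmp; congr (_ *: _).
by apply: eq_big_seq => v vtm; apply: h; apply: (allP (allP hp _ tmp)).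
Qed.
(** Each rule lowers the rank, so any fuel above the rank gives the same result; this is why [nform]
    obeys the fuel-free recursion [nform_rule]. *)
Lemma tbl_stable n m v : (rank v < n)%N -> (rank v < m)%N -> tbl n v = tbl m v.
Proof.
elim: n m v => [|n IH] [|m] v //= hn hm; case e1: (rule v) => [p|] //.
apply: (@phi_agree _ _ (fun w => (rank w < rank v)%N)); try exact: tbl_spar.
  by move=> w hw; apply: IH; lia.
exact: rule_rank.
Qed.
Definition nform (v : var) : salg R := tbl (rank v).+1 v.
Lemma nform_spar : spar nform. Proof. by move=> v; exact: tbl_spar. Qed.
Lemma nform_rule v p : rule v = Some p -> nform v = phi nform (cls p).
Proof.
move=> hv; rewrite {1}/nform [LHS]/= hv.
apply: (@phi_agree _ _ (fun w => (rank w < rank v)%N)); [exact: tbl_spar|exact: nform_spar| |exact: rule_rank].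
by move=> w hw; apply: tbl_stable.
Qed.
Lemma nform_base v : rule v = None -> nform v = X v.
Proof. by move=> hv; rewrite /nform /= hv. Qed.

Definition red := phi nform.
HB.instance Definition _ := GRing.Linear.on red.
Lemma redM x y : red (x * y) = red x * red y. Proof. exact: phiM nform_spar. Qed.
Lemma redD x y : red (x + y) = red x + red y. Proof. exact: phiD. Qed.
Lemma redB x y : red (x - y) = red x - red y. Proof. exact: phiB. Qed.
Lemma redZ c x : red (c *: x) = c *: red x. Proof. exact: phiZ. Qed.
Lemma redX v : red (X v) = nform v. Proof. exact: phiX nform_spar. Qed.
Lemma red0 : red 0 = 0. Proof. exact: phi_0. Qed.

Lemma Dm_gE k i j : Dm (k,i,j) (cls gE) = X (VU (k.+1,i.+1,j)) - cls (Dms (k,i,j) rE).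
Proof.
rewrite clsB DmB cls_Dms; congr (_ - _); rewrite -[cls (pv _ _)](_ : D 0 (D 1 (X (VU (0,0,0)%N))) = _).
  by rewrite !Dm_D // Dm_XU.
by rewrite DX -[cls _]/(X _) DX.
Qed.
Lemma Dm_gT k i j : Dm (k,i,j) (cls gT) = X (VQ (k.+1,i.+1,j)) - cls (Dms (k,i,j) rT).
Proof.
rewrite clsB DmB cls_Dms; congr (_ - _); rewrite -[cls (pv _ _)](_ : D 0 (D 1 (X (VQ (0,0,0)%N))) = _).
  by rewrite !Dm_D // Dm_XQ.
by rewrite DX -[cls _]/(X _) DX.
Qed.
Lemma Dm_gX k i j : Dm (k,i,j) (cls gX) = X (VW (k,i.+1,j)) - cls (Dms (k,i,j) rX).
Proof.
rewrite clsB DmB cls_Dms; congr (_ - _); rewrite -[cls (pv _ _)](_ : D 1 (X (VW (0,0,0)%N)) = _).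
  by rewrite !Dm_D // Dm_XW.
by rewrite DX.
Qed.
Lemma Dm_gY k i j : Dm (k,i,j) (cls gY) = X (VW (k,i,j.+1)) - cls (Dms (k,i,j) rY).
Proof.
rewrite clsB DmB cls_Dms; congr (_ - _); rewrite -[cls (pv _ _)](_ : D 2 (X (VW (0,0,0)%N)) = _).
  by rewrite !Dm_D // Dm_XW.
by rewrite DX.
Qed.

(* The compatibility of the two equations for w is the linearized equation. *)
Lemma gY_compat : D 1 (cls gY) = D 2 (cls gX) - cls gT.
Proof. rewrite -!cls_TD -clsB /gX /gY /gT /rX /rY /rT; spoly_norm. Qed.

Lemma red_gens s i : red (Dm s (nth 0 gens i)) = 0.
Proof.
case: s => [[k l] j].
have hT l' j' : red (Dm (k,l',j') (cls gT)) = 0.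
  by rewrite Dm_gT redB redX (@nform_rule _ (Dms (k,l',j') rT)) // subrr.
have hX l' j' : red (Dm (k,l',j') (cls gX)) = 0.
  by rewrite Dm_gX redB redX (@nform_rule _ (Dms (k,l',j') rX)) // subrr.
case: i => [|[|[|[|i]]]] /=; last by rewrite nth_nil Dm_0 red0.
- by rewrite Dm_gE redB redX (@nform_rule _ (Dms (k,l,j) rE)) // subrr.
- exact: hT.
- exact: hX.
case: l => [|l].
  by rewrite Dm_gY redB redX (@nform_rule _ (Dms (k,0%N,j) rY)) // subrr.
(* A w-letter with an x-derivative is rewritten by [rX], so this derivative of [gY] is not cancelled
   by its own rule; the compatibility expresses it through [gX] and [gT]. *)
rewrite -(@Dm_D _ 1 (k,l,j)) // gY_compat DmB redB hT subr0 Dm_D //; exact: hX.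
Qed.

Lemma gens_homog : homog gens.
Proof.
case=> [|[|[|[|i]]]]; rewrite ?[nth _ _ _]/=.
- by exists 0%N; exact: odeg_expl.
- by exists 1%N; exact: odeg_expl.
- by exists 1%N; exact: odeg_expl.
- by exists 1%N; exact: odeg_expl.
- by exists 0%N; rewrite nth_nil; exact: hdeg0.
Qed.

Lemma didl_red0 x : didl gens x -> red x = 0.
Proof.
elim/didl_ind=> [|y z hy hz|y s i]; first exact: red0.
  by rewrite redD hy hz addr0.
by rewrite redM red_gens mulr0.
Qed.

Lemma rule_didl v p : rule v = Some p -> didl gens (X v - cls p).
Proof.
case: v => [| | |[[[|k] [|i]] j]|[[[|k] [|i]] j]|[[k [|i]] [|j]]] //= [<-].
- rewrite -Dm_gE; exact: (@didl_gen _ gens _ 0).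
- rewrite -Dm_gT; exact: (@didl_gen _ gens _ 1).
- rewrite -Dm_gY; exact: (@didl_gen _ gens _ 3).
- rewrite -Dm_gX; exact: (@didl_gen _ gens _ 2).
- rewrite -Dm_gX; exact: (@didl_gen _ gens _ 2).
Qed.

(** Induction on the rank. Within a word the letters are replaced one at a time, the product
    difference telescoping. *)
Lemma sub_nform_didl v : didl gens (X v - nform v).
Proof.
move: {2}(rank v).+1 (ltnSn (rank v)) => n; elim: n v => // n IH v hv.
case e1: (rule v) => [p|]; last by rewrite nform_base // subrr; exact: didl0.
rewrite -[X v](subrK (cls p)) -addrA; apply: didlD; first exact: rule_didl.
rewrite (nform_rule e1) (phi_cls _ nform_spar) cls_sum -sumrB.
have := rule_rank e1; rewrite /letters_in; elim: p {e1} => [|[c s] p IHp] /=.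
  by rewrite big_nil => _; exact: didl0.
move=> /andP[hs hp]; rewrite big_cons; apply: didlD; last exact: IHp.
rewrite -scalerBr; apply: didlZ; elim: s hs => [|w s IHs] /=.
  by rewrite wd_nil big_nil subrr => _; exact: didl0.
move=> /andP[hw hs]; rewrite wd_cons big_cons -(subrKA (X w * \prod_(v0 <- s) nform v0)).
apply: didlD; first by rewrite -mulrBr; apply: didlMl; exact: IHs.
by rewrite -mulrBl; apply: didlMr; [exact: gens_homog | apply: IH; lia].
Qed.

Lemma sub_red_didl x : didl gens (x - red x).
Proof.
elim/salg_ind: x => [|c s x IH]; first by rewrite red0 subrr; exact: didl0.
rewrite redD redZ opprD addrACA; apply: didlD => //; rewrite -scalerBr; apply: didlZ.
elim: s => [|w s IHs]; first by rewrite wd_nil /red phi1 ?subrr; [exact: didl0 | exact: nform_spar].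
rewrite wd_cons redM redX -(subrKA (X w * red (wd s))).
apply: didlD; first by rewrite -mulrBr; apply: didlMl; exact: IHs.
by rewrite -mulrBl; apply: didlMr; [exact: gens_homog | exact: sub_nform_didl].
Qed.

(** [red] kills the ideal and changes an element only by a member of it. *)
Lemma red_eq0 x : red x = 0 <-> didl gens x.
Proof.
split=> [h|]; last exact: didl_red0.
by have := sub_red_didl x; rewrite h subr0.
Qed.
Lemma red_idem x : red (red x) = red x.
Proof. by apply/eqP; rewrite eq_sym -subr_eq0 -redB; apply/eqP/didl_red0/sub_red_didl. Qed.
End System.

(** * Substitutions and the change of base point *)

Section Subst.
Variable R : numFieldType.
Local Notation X := (X R).

Lemma phi_Der (a : var -> salg R) f g : spar a -> fsuper false f -> fsuper false g ->
  (forall v, phi a (cls (f v)) = Der false g (a v)) ->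
  forall x, phi a (Der false f x) = Der false g (phi a x).
Proof.
move=> ha hf hg h; apply: (@linear_ext _ _ (phi a \o Der false f) (Der false g \o phi a)) => /=.
  by rewrite phi1 // !Der1 // phi_0.
move=> v x IH; rewrite Der_Xmul // expr0 scale1r phiD !phiM // phiX // DerM //.
by rewrite h IH.
Qed.

Lemma hom_ext (h1 h2 : {linear salg R -> salg R}) : h1 1 = h2 1 ->
  (forall x y, h1 (x * y) = h1 x * h1 y) -> (forall x y, h2 (x * y) = h2 x * h2 y) ->
  (forall v, h1 (X v) = h2 (X v)) -> h1 =1 h2.
Proof. by move=> e1 m1 m2 hX; apply: linear_ext => // v x IH; rewrite m1 m2 hX IH. Qed.

Definition psubst (s : var -> spoly R) (p : spoly R) : spoly R :=
  flatten [seq pscale tm.1 (foldr (fun v r => pmul (s v) r) (pc 1) tm.2) | tm <- p].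
Lemma cls_psubst s p : spar (fun v => cls (s v)) ->
  cls (psubst s p) = phi (fun v => cls (s v)) (cls p).
Proof.
move=> hs; rewrite phi_cls // /psubst; elim: p => [|[c t] p IH]; first by rewrite big_nil.
rewrite big_cons /= -[_ ++ _]/(padd _ _) clsD IH clsZ; congr (_ *: _ + _).
elim: t => [|v t IHt] /=; first by rewrite big_nil cls_pc scale1r.
by rewrite big_cons clsM IHt.
Qed.

(* The substitution u = c x^2/2 + v. *)
Definition tausp (c : R) (v : var) : spoly R :=
  match v with
  | VU (0, 0, 0)%N => [:: (1, [:: v]); (c / 2, [:: Vx; Vx])]
  | VU (0, 1, 0)%N => [:: (1, [:: v]); (c, [:: Vx])]
  | VU (0, 2, 0)%N => [:: (1, [:: v]); (c, [::])]
  | _ => [:: (1, [:: v])]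
  end.
Lemma tau_spar c : spar (fun v => cls (tausp c v)).
Proof.
case=> [| | |[[[|k] [|[|[|i]]]] [|j]]|[[k i] j]|[[k i] j]]; exact: odeg_expl.
Qed.
Definition tau c := phi (fun v => cls (tausp c v)).
Lemma tauM c x y : tau c (x * y) = tau c x * tau c y. Proof. exact: phiM (tau_spar c). Qed.
Lemma tauX c v : tau c (X v) = cls (tausp c v). Proof. exact: phiX (tau_spar c). Qed.
Lemma tau_D c d x : (d < 3)%N -> tau c (D d x) = D d (tau c x).
Proof.
move=> hd; apply: phi_Der (tau_spar c) (Dsuper R d) (Dsuper R d) _ _ => v.
have l1 w : cls [:: (1, [:: w])] = X w by [].
have tX w : phi (fun v => cls (tausp c v)) (cls (pv R w)) = cls (tausp c w) by exact: tauX.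
case: v => [| | |[[[|k] [|[|[|i]]]] [|j]]|[[k i] j]|[[k i] j]];
  case: d hd => [|[|[|d]]] // _; rewrite -/(D _ _);
  rewrite ?[Dvar _ _ _]/= ?[tausp c _]/= ?tX ?l1 ?DX ?[tausp _ _]/= //;
  rewrite -?cls_psubst -?cls_TD; try exact: tau_spar; rewrite /psubst /tausp.
all: by spoly_field.
Qed.

(** The terms with coefficient [a] in the rules are those produced by u_x = a x + v_x and u_xx = a +
    v_xx. *)
Lemma tau_gens c i : tau c (nth 0 (gens (0:R) 1) i) = nth 0 (gens c 1) i.
Proof.
case: i => [|[|[|[|i]]]]; last by rewrite /= !nth_nil /tau phi_0.
all: rewrite /= /tau -cls_psubst; [|exact: tau_spar].
all: rewrite /psubst /tausp /gE /gT /gX /gY /rE /rT /rX /rY; spoly_field.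
Qed.
Lemma tauK c x : tau (- c) (tau c x) = x.
Proof.
have h : tau (- c) \o tau c =1 idfun.
  apply: (@hom_ext (phi _ \o phi _) idfun) => //=.
  - by rewrite !phi1 //; exact: tau_spar.
  - by move=> y z; rewrite !phiM //; exact: tau_spar.
  move=> v; rewrite -/(tau c (X v)) tauX -/(tau (- c) _).
  case: v => [| | |[[[|k] [|[|[|i]]]] [|j]]|[[k i] j]|[[k i] j]];
    try exact: tauX; rewrite /tau -cls_psubst; try exact: tau_spar;
    rewrite /psubst /tausp /X; spoly_field.
exact: h.
Qed.
Lemma tau_didl x : didl (gens (0:R) 1) x <-> didl (gens (1:R) 1) (tau 1 x).
Proof.
have sub (c a b : R) y : (forall i, tau c (nth 0 (gens a 1) i) = nth 0 (gens b 1) i) ->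
    didl (gens a 1) y -> didl (gens b 1) (tau c y).
  move=> h; apply: didl_subst.
  - by move=> *; exact: phiD.
  - exact: phi_0.
  - exact: tauM.
  - exact: tau_D.
  - by move=> i; rewrite h; exact: (@didl_gen _ _ (0,0,0)%N i).
split; first exact: (sub _ _ _ _ (tau_gens 1)).
move=> h; rewrite -[x](tauK 1); apply: sub h => // i.
by rewrite -tau_gens tauK.
Qed.
End Subst.

Definition isU (v : var) : bool := match v with VU _ => true | _ => false end.

(** * Degree in the letters u *)

Section Grading.
Variable R : numFieldType.
Local Notation X := (X R).
Local Notation wd := (wd R).
Implicit Types x y : salg R.

Definition gr (d : nat) : salg R -> salg R :=
  Lin (fun s => if count isU s == d then wd s else 0).
HB.instance Definition _ d := GRing.Linear.on (gr d).
Lemma gr_supersym d : supersym (fun s => if count isU s == d then wd s else 0).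
Proof.
move=> s1 a b s2; rewrite (permP (perm_swap s1 a b s2)).
by case: ifP => _; [exact: wd_supersym | rewrite scaler0].
Qed.
Lemma grD d x y : gr d (x + y) = gr d x + gr d y. Proof. exact: linearD. Qed.
Lemma grB d x y : gr d (x - y) = gr d x - gr d y. Proof. exact: linearB. Qed.
Lemma grZ d c x : gr d (c *: x) = c *: gr d x. Proof. exact: linearZ. Qed.
Lemma gr0 d : gr d 0 = 0. Proof. exact: linear0. Qed.
Lemma gr_wd d s : gr d (wd s) = if count isU s == d then wd s else 0.
Proof. by rewrite /gr Lin_wd //; exact: gr_supersym. Qed.
Lemma gr_hdeg n d x : hdeg isU n x -> gr d x = if n == d then x else 0.
Proof.
elim/hdeg_ind => [|c s {}x hs IH]; first by rewrite gr0; case: ifP.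
by rewrite grD grZ gr_wd IH hs; case: ifP; rewrite ?scaler0 ?addr0.
Qed.
Lemma gr_cls d p : gr d (cls p) = cls (filter (fun tm => count isU tm.2 == d) p).
Proof.
elim: p => [|[c s] p IH] /=; first by rewrite gr0.
by rewrite cls_cons grD grZ gr_wd IH; case: ifP; rewrite ?cls_cons // scaler0 add0r.
Qed.
Lemma hdeg_gr_odeg P n d x : hdeg P n x -> hdeg P n (gr d x).
Proof.
elim/hdeg_ind => [|c s {}x hs IH]; first by rewrite gr0; exact: hdeg0.
rewrite grD grZ gr_wd; apply: hdegD => //; apply: hdegZ.
by case: ifP => _; [rewrite -hs; exact: hdeg_wd | exact: hdeg0].
Qed.
Lemma D_hdegU d n x : hdeg isU n x -> hdeg isU n (D d x).
Proof. by apply: Der_hdeg; [exact: Dsuper | exact: Dvar_hspar]. Qed.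
Lemma gr_D e d x : gr e (D d x) = D d (gr e x).
Proof.
elim/salg_ind: x => [|c s x IH]; first by rewrite gr0 D_0 gr0.
rewrite DP !grD !grZ DP IH gr_wd (gr_hdeg _ (D_hdegU d (hdeg_wd R isU s))).
by case: ifP; rewrite ?D_0.
Qed.
Lemma gr_Dm e s x : gr e (Dm s x) = Dm s (gr e x).
Proof.
have it d n y : gr e (iter n (D d) y) = iter n (D d) (gr e y).
  by elim: n => //= n <-; exact: gr_D.
by rewrite /Dm !it.
Qed.
Lemma gr_hM n e x y : hdeg isU n x ->
  gr e (x * y) = if (n <= e)%N then x * gr (e - n) y else 0.
Proof.
move=> hx; elim/salg_ind: y => [|c s y IH].
  by rewrite mulr0 !gr0 mulr0; case: ifP.
rewrite mulrDr -scalerAr grD grZ IH (gr_hdeg _ (hdegM hx (hdeg_wd R isU s))).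
rewrite grD grZ gr_wd; case: leqP => h; last first.
  by rewrite addr0; case: eqP => [e1|_]; [lia | rewrite scaler0].
rewrite mulrDr -scalerAr; congr (_ *: _ + _).
have -> : (count isU s == e - n)%N = (n + count isU s == e)%N by lia.
by case: ifP; rewrite ?mulr0.
Qed.
Lemma gr_mul e x y : gr e (x * y) = \sum_(i < e.+1) gr i x * gr (e - i) y.
Proof.
elim/salg_ind: x => [|c s x IH].
  by rewrite mul0r gr0 big1 // => i _; rewrite gr0 mul0r.
rewrite mulrDl -scalerAl grD grZ IH (gr_hM e y (hdeg_wd R isU s)).
under [in RHS]eq_bigr => i _ do rewrite grD grZ gr_wd mulrDl -scalerAl.
rewrite big_split /= -scaler_sumr; congr (_ *: _ + _).
case: leqP => h; last first.
  rewrite big1 // => i _; case: eqP => [e1|_]; last by rewrite mul0r.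
  by have := ltn_ord i; lia.
have h' : (count isU s < e.+1)%N by [].
rewrite (bigD1 (Ordinal h')) //= eqxx big1 ?addr0 // => i ii.
case: eqP => [e1|_]; last by rewrite mul0r.
by case/negP: ii; apply/eqP; apply: ord_inj.
Qed.

Definition fil (d : nat) x := forall e, (e < d)%N -> gr e x = 0.
Lemma fil_rep d x : fil d x ->
  exists2 p, x = cls p & all (fun tm => (d <= count isU tm.2)%N) p.
Proof.
move=> hx; exists (filter (fun tm => (d <= count isU tm.2)%N) (rep x)); last exact: filter_all.
have split p : cls p = cls (filter (fun tm => (d <= count isU tm.2)%N) p) +
    \sum_(e < d) gr e (cls p).
  elim: p => [|[c s] p IH]; first by rewrite big1 ?addr0 // => e _; rewrite gr0.
  rewrite cls_cons {1}IH /=; under [in RHS]eq_bigr => e _ do rewrite grD grZ gr_wd.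
  rewrite big_split /= -scaler_sumr; case: leqP => h.
    rewrite cls_cons [X in _ + (c *: X + _)]big1 ?scaler0 ?add0r ?addrA // => e _.
    by case: eqP => // e1; have := ltn_ord e; lia.
  rewrite [X in _ + (c *: X + _)](bigD1 (Ordinal h)) //= eqxx [X in _ + (c *: (_ + X) + _)]big1 ?addr0 1?addrCA // => i ii.
  by case: eqP => // e1; case/negP: ii; apply/eqP; apply: ord_inj.
rewrite -{1}(repK x) {1}split repK big1 ?addr0 // => e _; exact: hx.
Qed.
Lemma gr_eq0 x : (forall e, gr e x = 0) -> x = 0.
Proof.
move=> h; rewrite -(repK x) in h *; move: (rep x) h => p h.
pose N := (\max_(tm <- p) count isU tm.2).+1.
have [q e1 hq] := @fil_rep N (cls p) (fun e _ => h e).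
have : cls p = \sum_(e < N) gr e (cls p).
  rewrite {h e1 hq q}; rewrite cls_sum; have : all (fun tm => count isU tm.2 < N)%N p.
    by apply/allP => tm tmp; rewrite ltnS; apply: (@leq_bigmax_seq _ p xpredT (fun tm : R * seq var => count isU tm.2)) => //.
  move: N => N; elim: p => [|[c s] p IH] /= hN.
    by rewrite !big_nil big1 // => e _; rewrite gr0.
  have /andP[h1 h2] := hN; rewrite !big_cons /= {1}IH //.
  under [in RHS]eq_bigr => e _ do rewrite grD grZ gr_wd.
  rewrite big_split /= -scaler_sumr [X in _ = c *: X + _](bigD1 (Ordinal h1)) //= eqxx.
  rewrite [X in _ = c *: (_ + X) + _]big1 ?addr0 // => i ii.
  by case: eqP => // e1; case/negP: ii; apply/eqP; apply: ord_inj.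
by rewrite big1.
Qed.

(** The expansion of [x] in the degree in u starts in degree d, with component [y] there; this
    relation is multiplicative. *)
Definition lead d x y := forall e, (e <= d)%N -> gr e x = if e == d then y else 0.
Lemma lead_mul k l x y x' y' : lead k x y -> lead l x' y' -> lead (k + l) (x * x') (y * y').
Proof.
move=> h h' e he; rewrite gr_mul; case: eqP => [ek|ek]; last first.
  rewrite big1 // => -[i hi] _ /=; case: (ltnP i k) => ik.
    by rewrite h 1?ltnW // ltn_eqF // mul0r.
  by rewrite [X in _ * X]h'; last lia; rewrite ifF ?mulr0 //; apply/eqP; lia.
have kE : (k < e.+1)%N by lia.
rewrite (bigD1 (Ordinal kE)) //= h // eqxx h'; last lia.
have -> : (e - k == l)%N by lia.
rewrite big1 ?addr0 // => -[i hi] ik /=.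
have {}ik : i <> k by move=> e1; case/negP: ik; apply/eqP; apply: ord_inj.
case: (ltnP i k) => ik'; first by rewrite h 1?ltnW // ltn_eqF // mul0r.
by rewrite [X in _ * X]h'; last lia; rewrite ifF ?mulr0 //; apply/eqP; lia.
Qed.
Lemma lead_phi (T1 T0 : var -> salg R) : spar T1 -> spar T0 ->
  (forall v, lead (isU v) (T1 v) (T0 v)) ->
  forall d x, fil d x -> lead d (phi T1 x) (phi T0 (gr d x)).
Proof.
move=> h1 h0 h d x hx; have [p -> hp] := fil_rep hx.
elim: p hp => [|[c s] p IH] /=.
  by move=> _ e _; rewrite gr0 !phi_0 gr0; case: ifP.
move=> /andP[hs hp] e he; rewrite cls_cons phiP grD grZ (IH hp) // grD grZ phiP gr_wd.
have hw : lead (count isU s) (phi T1 (wd s)) (phi T0 (wd s)).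
  rewrite !phi_wd //; elim: s {hs} => [|v s IHs] /=.
    rewrite !big_nil => e' /=; rewrite leqn0 => /eqP -> /=.
    by rewrite -wd_nil gr_wd.
  by rewrite !big_cons; exact: lead_mul.
rewrite hw; last by lia.
case: (e =P d) => [ed|ed]; last first.
  by rewrite ifF ?scaler0 ?addr0 //; apply/eqP; lia.
by rewrite ed (eq_sym d); case: ifP => _; rewrite ?phi_0.
Qed.

(** In each rule the terms with coefficient [e] contain one letter u more than the others, so
    rewriting with e = 1 and with e = 0 agree in lowest degree: degree one for a letter u, degree
    zero for the others. *)
Lemma lead_nform v : lead (isU v) (nform (1:R) 1 v) (nform (1:R) 0 v).
Proof.
rewrite /nform; move: (rank v).+1 => n; elim: n v => [|n IH] v /=.
  by move=> e he; rewrite (gr_hdeg _ (hdegX R isU v)) eq_sym.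
have ext p1 p0 : fil (isU v) (cls p1) -> gr (isU v) (cls p1) = cls p0 ->
    lead (isU v) (phi (tbl (1:R) 1 n) (cls p1)) (phi (tbl (1:R) 0 n) (cls p0)).
  by move=> h <-; apply: lead_phi => //; exact: tbl_spar.
have base : lead (isU v) (X v) (X v).
  by move=> e he; rewrite (gr_hdeg _ (hdegX R isU v)) eq_sym.
case: v base ext => [| | |[[[|k] [|i]] j]|[[[|k] [|i]] j]|[[k [|i]] [|j]]] //= base ext; apply: ext;
  rewrite !cls_Dms ?gr_Dm.
- by move=> [|//] _; rewrite gr_Dm gr_cls /= Dm_0.
- congr (Dm _ _); rewrite gr_cls /= /rE; spoly_norm.
all: try by [].
all: congr (Dm _ _); rewrite gr_cls /= /rT /rX /rY; spoly_norm.
Qed.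
Lemma lead_red d x : fil d x -> lead d (red 1 1 x) (red 1 0 (gr d x)).
Proof. by apply: lead_phi; [exact: nform_spar|exact: nform_spar|exact: lead_nform]. Qed.
End Grading.

(** * The linearized system *)

Section OddPartial.
Variable R : numFieldType.
Local Notation X := (X R).
Local Notation wd := (wd R).
Implicit Types x y : salg R.

Lemma DerM_odd f n y x : fsuper true f -> odeg n y ->
  Der true f (y * x) = Der true f y * x + (-1) ^+ n *: (y * Der true f x) :> salg R.
Proof.
move=> hf; elim/hdeg_ind => [|c s {}y hs IH].
  by rewrite !mul0r Der_0 mul0r scaler0 addr0.
rewrite mulrDl -scalerAl !DerP IH !mulrDl scalerDr -!scalerAl addrACA scalerA mulrC -scalerA -scalerDr.
congr (_ *: _ + _); rewrite -hs; elim: s {hs} => [|v s IHs] /=.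
  by rewrite wd_nil !mul1r Der1 // mul0r add0r scale1r.
rewrite !wd_cons -!mulrA !Der_Xmul // IHs mulrDl !mulrDr scalerDr -!addrA !mulrA; congr (_ + _).
rewrite -!scalerAl -!scalerAr !scalerA mulrA; congr (_ + _ *: _).
by rewrite exprD; case: (odd_var v).
Qed.

Definition pdf (u v : var) : spoly R := if v == u then pc 1 else [::].
Definition pd u : salg R -> salg R := Der true (pdf u).
HB.instance Definition _ u := GRing.Linear.on (pd u).
Lemma cls_pdf u v : cls (pdf u v) = (v == u)%:R.
Proof. by rewrite /pdf; case: ifP => _; rewrite ?cls_pc ?scale1r. Qed.
Lemma pd_super u : odd_var u -> fsuper true (pdf u).
Proof.
move=> ou v w; rewrite cls_pdf; case: eqP => [->|_]; rewrite ?mul0r ?mulr0 ?scaler0 //.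
by rewrite ou mul1r mulr1 scale1r.
Qed.
Lemma pdD u x y : pd u (x + y) = pd u x + pd u y. Proof. exact: linearD. Qed.
Lemma pdN u x : pd u (- x) = - pd u x. Proof. exact: linearN. Qed.
Lemma pdZ u c x : pd u (c *: x) = c *: pd u x. Proof. exact: linearZ. Qed.
Lemma pd0 u : pd u 0 = 0. Proof. exact: linear0. Qed.
Lemma pdX u v : odd_var u -> pd u (X v) = (v == u)%:R.
Proof. by move=> ou; rewrite /pd DerX ?cls_pdf //; exact: pd_super. Qed.
Lemma pd1 u : odd_var u -> pd u 1 = 0.
Proof. by move=> ou; rewrite /pd Der1 //; exact: pd_super. Qed.
Lemma pd_Xmul u v x : odd_var u ->
  pd u (X v * x) = (v == u)%:R * x + (-1) ^+ odd_var v *: (X v * pd u x).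
Proof. by move=> ou; rewrite /pd Der_Xmul ?cls_pdf //; exact: pd_super. Qed.
Lemma pd_even_mul u y x : odd_var u -> odeg 0 y -> pd u y = 0 -> pd u (y * x) = y * pd u x.
Proof.
move=> ou hy y0; rewrite /pd (DerM_odd x (pd_super ou) hy) -/(pd u y) y0.
by rewrite mul0r add0r scale1r.
Qed.

(** The first clause makes up for the truncated predecessor: in odd degree zero the derivative must
    vanish, and the induction on the word uses this. *)
Lemma pd_wd_odeg u s : odd_var u ->
  (count odd_var s = 0%N -> pd u (wd s) = 0) /\ odeg (count odd_var s).-1 (pd u (wd s)).
Proof.
move=> ou; elim: s => [|v s [IH0 IH]] /=.
  by rewrite wd_nil pd1 //; split=> //; exact: hdeg0.
rewrite wd_cons pd_Xmul //; case ov: (odd_var v) => /=; last first.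
  have vu : (v == u) = false by apply/eqP => e; rewrite e ou in ov.
  rewrite vu mul0r add0r scale1r add0n; split=> [/IH0 ->|]; first by rewrite mulr0.
  by apply: odegM_eq (hdegX R odd_var v) IH _; rewrite ov.
split=> [|]; first by lia.
apply: hdegD.
  by case: (v == u); rewrite ?mul1r ?mul0r; [exact: hdeg_wd | exact: hdeg0].
apply: hdegZ; case: (posnP (count odd_var s)) => [e|e].
  by rewrite IH0 // mulr0; exact: hdeg0.
by apply: odegM_eq (hdegX R odd_var v) IH _; rewrite ov /=; lia.
Qed.
Lemma pd_odeg u n x : odd_var u -> odeg n.+1 x -> odeg n (pd u x).
Proof.
move=> ou; elim/hdeg_ind => [|c s {}x hs IH]; first by rewrite pd0; exact: hdeg0.
rewrite pdD pdZ; apply: hdegD => //; apply: hdegZ.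
by have [_] := pd_wd_odeg s ou; rewrite hs.
Qed.
Lemma pd_notin u s : odd_var u -> u \notin s -> pd u (wd s) = 0.
Proof.
move=> ou; elim: s => [|v s IH]; first by rewrite wd_nil pd1.
rewrite inE negb_or eq_sym => /andP[/negbTE h1 h2].
by rewrite wd_cons pd_Xmul // h1 mul0r add0r IH // mulr0 scaler0.
Qed.

Lemma euler (us : seq var) s : uniq us -> {subset filter odd_var s <= us} -> all odd_var us ->
  \sum_(u <- us) X u * pd u (wd s) = (count odd_var s)%:R *: wd s.
Proof.
move=> uus; elim: s => [|v s IH] hs ous.
  by rewrite scale0r big1_seq // => u /andP[_ uu]; rewrite wd_nil pd1 ?mulr0 ?(allP ous).
have hs' : {subset filter odd_var s <= us}.
  by move=> w hw; apply: hs => /=; case: ifP; rewrite ?inE hw ?orbT.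
transitivity (\sum_(u <- us) (X u * ((v == u)%:R * wd s)) + X v * \sum_(u <- us) X u * pd u (wd s)).
  rewrite mulr_sumr -big_split; apply: eq_big_seq => u uu; have ou := allP ous u uu.
  rewrite wd_cons pd_Xmul // mulrDr; congr (_ + _).
  rewrite -scalerAr !mulrA (XX R u v) ou -scalerAl scalerA -exprD.
  by case: (odd_var v); rewrite /= ?scale1r // -signr_odd /= scale1r.
rewrite IH // -scalerAr -wd_cons /= natrD scalerDl; congr (_ + _).
case ov: (odd_var v); last first.
  rewrite scale0r big1_seq // => u /andP[_ uu]; case: eqP => [e|_]; last by rewrite mul0r mulr0.
  by have := allP ous u uu; rewrite -e ov.
have vin : v \in us by apply: hs; rewrite /= ov inE eqxx.
rewrite (bigD1_seq v) //= eqxx mul1r -wd_cons scale1r big1 ?addr0 // => u uv.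
by rewrite eq_sym (negbTE uv) mul0r mulr0.
Qed.
(** By Euler's identity the sum of X u times the derivative by u is (n+1) x, and n+1 is
    invertible. *)
Lemma odeg_pd0 n x : odeg n.+1 x -> (forall u, odd_var u -> pd u x = 0) -> x = 0.
Proof.
case=> p -> hp h; pose us := undup (filter odd_var (flatten (map snd p))).
have ous : all odd_var us.
  by apply/allP => u; rewrite mem_undup mem_filter => /andP[].
have : \sum_(u <- us) X u * pd u (cls p) = n.+1%:R *: cls p.
  have : {subset p <= p} by [].
  move: {1 3 4}p => q sub; rewrite cls_sum.
  transitivity (\sum_(tm <- q) tm.1 *: \sum_(u <- us) X u * pd u (wd tm.2)).
    under [LHS]eq_bigr => u _ do rewrite linear_sum mulr_sumr.
    rewrite exchange_big /=; apply: eq_bigr => tm _; rewrite scaler_sumr.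
    by apply: eq_bigr => u _; rewrite linearZ scalerAr.
  rewrite scaler_sumr; apply: eq_big_seq => tm tmq.
  rewrite euler ?undup_uniq // ?(eqP (allP hp tm (sub _ tmq))); first by rewrite !scalerA mulrC.
  move=> w; rewrite mem_filter => /andP[ow wt]; rewrite mem_undup mem_filter ow /=.
  by apply/flattenP; exists tm.2 => //; apply/mapP; exists tm => //; exact: sub.
rewrite big1_seq => [/esym/eqP|u /andP[_ uu]]; last by rewrite h ?mulr0 // (allP ous).
by rewrite scaler_eq0 pnatr_eq0 /= => /eqP.
Qed.

(* The commutator of d/du with an even derivation f is again an odd derivation,
   so it is determined by its values on letters. *)
Lemma pd_comm u f (E : {linear salg R -> salg R}) : odd_var u ->
  spar (fun v => cls (f v)) -> E 1 = 0 ->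
  (forall v x, E (X v * x) = E (X v) * x + (-1) ^+ odd_var v *: (X v * E x)) ->
  (forall v, pd u (cls (f v)) = E (X v)) ->
  forall x, pd u (Der false f x) = Der false f (pd u x) + E x.
Proof.
move=> ou hf E1 EX hE; have hs := fsuper_even hf.
apply: (@linear_ext _ _ (pd u \o Der false f) (Der false f \o pd u \+ E)) => /=.
  by rewrite E1 addr0 Der1 // pd0 pd1 // Der_0.
move=> v x IH; rewrite Der_Xmul // expr0 scale1r pdD {1}/pd (DerM_odd x (pd_super ou) (hf v)).
rewrite -/(pd u (cls (f v))) -/(pd u x) hE !pd_Xmul // IH EX DerD DerZ !DerM // DerX //.
have -> : Der false f (v == u)%:R = 0.
  by case: (v == u); rewrite ?Der_0 // Der1.
rewrite mul0r add0r mulrDr !scalerDr.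
move: (_ *: (_ * Der _ _ (pd u x))) (_ * Der _ _ x) (_ *: (cls _ * _)) (_ * x) (_ *: (_ * E x)) => A B C D' F.
linear_ring R (salg R).
Qed.
End OddPartial.

(** * The chain coordinates *)

Section Chain.
Variable R : numFieldType.
Local Notation X := (X R).
Implicit Types x y : salg R.

(* None, Some false, Some true stand for the families u, q, w. *)
Definition mk (k : option bool) (s m j : nat) : var :=
  match k with None => VU (s, m, j) | Some false => VQ (s, m, j) | Some true => VW (s, m, j) end.
(** The parameter c in z_tx = (4 - 2c) z_y + 4 x z_xy - z_xxxy at the bottom of a chain: c = 1 for
    u, and c = 3 for x q - w/2, which occupies the w family. *)
Definition ck (k : option bool) : R := if k is None then 1 else 3.

Lemma mk_eq k s m j k' s' m' j' :
  (mk k s m j == mk k' s' m' j') = [&& k == k', s == s', m == m' & j == j'].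
Proof.
apply/eqP/and4P => [|[/eqP-> /eqP-> /eqP-> /eqP->] //].
by case: k k' => [[|]|] [[|]|] //= [-> -> ->].
Qed.
Lemma odd_mk k s m j : odd_var (mk k s m j) = (k != None).
Proof. by case: k => [[|]|]. Qed.

(* The letter (s, m) stands for dx^m z_s, where
     dy z_s = - dx z_(s+1) / 2,
     dt z_s = (c + 2 s) z_(s+1) - 2 x dx z_(s+1) + dx^3 z_(s+1) / 2;
   the index j plays no role. *)
Definition ft_mk k s m j : spoly R :=
  [:: (ck k + 2 * s%:R - 2 * m%:R, [:: mk k s.+1 m j]);
      (- 2, [:: Vx; mk k s.+1 m.+1 j]); (1 / 2, [:: mk k s.+1 m.+3 j])].
Definition fd (d : nat) (v : var) : spoly R :=
  match d with
  | 0 => match v with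
    | Vt => pc 1 | Vx | Vy => [::]
    | VU (s, m, j) => ft_mk None s m j
    | VQ (s, m, j) => ft_mk (Some false) s m j
    | VW (s, m, j) => ft_mk (Some true) s m j end
  | 1 => Dvar R 1 v
  | _ => match v with
    | Vy => pc 1 | Vx | Vt => [::]
    | VU (s, m, j) => [:: (- (1 / 2), [:: VU (s.+1, m.+1, j)])]
    | VQ (s, m, j) => [:: (- (1 / 2), [:: VQ (s.+1, m.+1, j)])]
    | VW (s, m, j) => [:: (- (1 / 2), [:: VW (s.+1, m.+1, j)])] end
  end%N.
Definition dd d : salg R -> salg R := Der false (fd d).
HB.instance Definition _ d := GRing.Linear.on (dd d).

Lemma fd_spar d : spar (fun v => cls (fd d v)).
Proof.
case: d => [|[|d]]; try exact: Dvar_hspar;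
by case=> [| | |[[s m] j]|[[s m] j]|[[s m] j]]; exact: odeg_expl.
Qed.
Lemma fd_super d : fsuper false (fd d).
Proof. exact: fsuper_even (fd_spar d). Qed.
Lemma ddD d x y : dd d (x + y) = dd d x + dd d y. Proof. exact: linearD. Qed.
Lemma ddB d x y : dd d (x - y) = dd d x - dd d y. Proof. exact: linearB. Qed.
Lemma ddN d x : dd d (- x) = - dd d x. Proof. exact: linearN. Qed.
Lemma ddZ d c x : dd d (c *: x) = c *: dd d x. Proof. exact: linearZ. Qed.
Lemma dd0 d : dd d 0 = 0. Proof. exact: linear0. Qed.
Lemma dd1 d : dd d 1 = 0. Proof. exact: Der1 (fd_super d). Qed.
Lemma ddM d x y : dd d (x * y) = dd d x * y + x * dd d y.
Proof. exact: DerM (fd_super d). Qed.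
Lemma ddX d v : dd d (X v) = cls (fd d v). Proof. exact: DerX (fd_super d). Qed.
Lemma dd_odeg d n x : odeg n x -> odeg n (dd d x).
Proof. exact: Der_hdeg (fd_super d) (fd_spar d). Qed.
Lemma cls1 c v : cls [:: (c, [:: v])] = c *: X v.
Proof. by rewrite cls_cons wd_cons wd_nil mulr1 addr0. Qed.
Lemma ddt_mk k s m j : dd 0 (X (mk k s m j)) =
  (ck k + 2 * s%:R - 2 * m%:R) *: X (mk k s.+1 m j) - 2 *: (X Vx * X (mk k s.+1 m.+1 j))
  + (1 / 2) *: X (mk k s.+1 m.+3 j).
Proof.
rewrite ddX (_ : fd 0 _ = ft_mk k s m j); last by case: k => [[|]|].
by rewrite /ft_mk !cls_cons !wd_cons wd_nil !mulr1 addr0 scaleNr addrA.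
Qed.
Lemma ddx_mk k s m j : dd 1 (X (mk k s m j)) = X (mk k s m.+1 j).
Proof. by rewrite ddX; case: k => [[|]|]. Qed.
Lemma ddy_mk k s m j : dd 2 (X (mk k s m j)) = - (1 / 2) *: X (mk k s.+1 m.+1 j).
Proof. by rewrite ddX; case: k => [[|]|]; rewrite -cls1. Qed.
Lemma dd_Vx d : dd d (X Vx) = (d == 1%N)%:R.
Proof. by rewrite ddX; case: d => [|[|d]] //=; rewrite cls_pc scale1r. Qed.

Lemma dd_mk_ind (P : var -> Prop) : P Vt -> P Vx -> P Vy -> (forall k s m j, P (mk k s m j)) ->
  forall v, P v.
Proof.
move=> h1 h2 h3 h; case=> [| | |[[s m] j]|[[s m] j]|[[s m] j]] //.
- exact: (h None).
- exact: (h (Some false)).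
- exact: (h (Some true)).
Qed.
(** The coefficient c + 2s - 2m is made for this: raising m absorbs the derivative of the factor x,
    and raising s and m together leaves it unchanged. *)
Lemma dd_comm_lt d e x : (d < e < 3)%N -> dd d (dd e x) = dd e (dd d x).
Proof.
move=> de; apply: Der_comm; try exact: fd_super.
elim/dd_mk_ind; try by case: d e de => [|[|[|d]]] [|[|[|e]]] //= _;
  rewrite ?cls_pc ?scale1r ?Der_0 // -/(dd _ _) ?dd1.
move=> k s m j; rewrite -/(dd d _) -/(dd e _) -!ddX.
case: d e de => [|[|[|d]]] [|[|[|e]]] //= _.
- rewrite ddt_mk ddx_mk !ddD !ddN !ddZ ddM dd_Vx !ddx_mk ddt_mk /= !mul1r.
  linear_ring R (salg R).
- rewrite ddt_mk ddy_mk !ddD !ddN !ddZ ddM dd_Vx !ddy_mk ddt_mk /= mul0r add0r -scalerAr.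
  linear_ring R (salg R).
- by rewrite ddx_mk !ddy_mk ddZ !ddx_mk.
Qed.
Lemma dd_comm d e x : (d < 3)%N -> (e < 3)%N -> dd d (dd e x) = dd e (dd d x).
Proof.
move=> hd he; case: (ltngtP d e) => [h|h|->] //; first by rewrite dd_comm_lt ?h.
by rewrite [RHS]dd_comm_lt ?h.
Qed.

Section KindPartial.
Variables (k : option bool) (j : nat).
Hypothesis hk : k != None.
(* d/dZ_{s,m-r}, with Z_{s,m} = 0 for negative m *)
Definition pl (s r m : nat) x : salg R := if (r <= m)%N then pd (mk k s (m - r) j) x else 0.
Fact pl_linear s r m : linear (pl s r m).
Proof.
by move=> c x y; rewrite /pl; case: ifP => _; rewrite ?scaler0 ?addr0 // pdD pdZ.
Qed.
HB.instance Definition _ s r m :=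
  GRing.isLinear.Build R (salg R) (salg R) *:%R (pl s r m) (pl_linear s r m).
Let ok s m : odd_var (mk k s m j). Proof. by rewrite odd_mk. Qed.
Lemma pl1 s r m : pl s r m 1 = 0.
Proof. by rewrite /pl; case: ifP => _ //; rewrite pd1. Qed.
Lemma pl_Xmul s r m v x :
  pl s r m (X v * x) = pl s r m (X v) * x + (-1) ^+ odd_var v *: (X v * pl s r m x).
Proof.
rewrite /pl; case: ifP => _; first by rewrite pd_Xmul // pdX.
by rewrite mulr0 mul0r scaler0 addr0.
Qed.
Lemma plX s r m k' s' m' j' : pl s r m (X (mk k' s' m' j')) =
  [&& k' == k, s' == s, (m' + r)%N == m & j' == j]%:R.
Proof.
rewrite /pl; case: leqP => h.
  by rewrite pdX // mk_eq (_ : (m' == m - r)%N = (m' + r == m)%N) //; lia.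
by case: and4P => // -[_ _ /eqP e _]; lia.
Qed.
Lemma plX0 s r m v : v = Vt \/ v = Vx \/ v = Vy -> pl s r m (X v) = 0.
Proof.
by move=> h; rewrite /pl; case: ifP => _ //; rewrite pdX //;
  case: h => [->|[->|->]]; case: (k) => [[|]|].
Qed.

Lemma pd_dx s m x : pd (mk k s m j) (dd 1 x) = dd 1 (pd (mk k s m j) x) + pl s 1 m x.
Proof.
apply: pd_comm => //; [exact: fd_spar | exact: pl1 | exact: pl_Xmul |].
elim/dd_mk_ind => [| | |k' s' m' j']; rewrite -ddX /=.
- by rewrite plX0; [rewrite ddX pd0 | left].
- by rewrite plX0; [rewrite dd_Vx pd1 | right; left].
- by rewrite plX0; [rewrite ddX pd0 | right; right].
by rewrite ddx_mk plX pdX // mk_eq addn1.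
Qed.
Lemma pd_dy s m x :
  pd (mk k s.+1 m j) (dd 2 x) = dd 2 (pd (mk k s.+1 m j) x) - (1 / 2) *: pl s 1 m x.
Proof.
rewrite -scaleNr; apply: (@pd_comm _ _ _ (- (1 / 2) \*: pl s 1 m)) => //; first exact: fd_spar.
- by rewrite /= pl1 scaler0.
- by move=> v y; rewrite /= pl_Xmul -scalerAl -scalerAr; linear_ring R (salg R).
elim/dd_mk_ind => [| | |k' s' m' j']; rewrite -ddX /=.
- by rewrite plX0; [rewrite ddX pd0 scaler0 | left].
- by rewrite plX0; [rewrite dd_Vx pd0 scaler0| right; left].
- by rewrite plX0; [rewrite ddX cls_pc scale1r pd1 ?scaler0| right; right].
by rewrite ddy_mk plX pdZ pdX // mk_eq addn1 eqSS.
Qed.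
Lemma pd_dt s m x : pd (mk k s.+1 m j) (dd 0 x) = dd 0 (pd (mk k s.+1 m j) x)
  + ((ck k + 2 * s%:R - 2 * m%:R) *: pl s 0 m x - 2 *: (X Vx * pl s 1 m x)
     + (1 / 2) *: pl s 3 m x).
Proof.
pose E x : salg R := (ck k + 2 * s%:R - 2 * m%:R) *: pl s 0 m x - 2 *: (X Vx * pl s 1 m x)
     + (1 / 2) *: pl s 3 m x.
have lE : linear E.
  move=> c y z; rewrite /E !linearP /= mulrDr -scalerAr.
  linear_ring R (salg R).
pose HE := GRing.isLinear.Build R (salg R) (salg R) *:%R E lE.
pose LE : {linear salg R -> salg R} := HB.pack E HE.
apply: (@pd_comm _ _ _ LE) => //; first exact: fd_spar.
- by rewrite /= /E !pl1 mulr0 !scaler0 subr0 addr0.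
- move=> v y; rewrite /= /E !pl_Xmul !mulrDr !mulrDl -!scalerAr !mulrA.
  rewrite (odeg0_central (X v) (hdegX R odd_var Vx)) mulNr -!scalerAl.
  linear_ring R (salg R).
elim/dd_mk_ind => [| | |k' s' m' j']; rewrite -ddX [LE _]/(E _) /E.
- by rewrite !plX0; try (by left); rewrite mulr0 !scaler0 ddX cls_pc scale1r pd1 // subr0 addr0.
- by rewrite !plX0; try (by right; left); rewrite mulr0 !scaler0 dd_Vx pd0 subr0 addr0.
- by rewrite !plX0; try (by right; right); rewrite mulr0 !scaler0 ddX pd0 subr0 addr0.
rewrite ddt_mk !plX !pdD pdN !pdZ pd_even_mul //; last 2 first.
- exact: (hdegX R odd_var Vx).
- by rewrite pdX //; case: (k) => [[|]|].
rewrite !pdX // !mk_eq addn0 addn1 addn3 !eqSS.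
congr (_ - _ + _).
case: and4P => [[/eqP -> /eqP -> /eqP -> _] //|_]; first by rewrite !scaler0.
Qed.
End KindPartial.
End Chain.

(** * Uniqueness in chain coordinates *)

Section ChainUniqueness.
Variable R : numFieldType.
Local Notation X := (X R).
Implicit Types x y : salg R.

(** Only finitely many letters occur in an element; the bound is where the descending inductions
    below start. *)
Lemma pd_bound x : exists N, forall k s m j, k != None -> (N <= s)%N \/ (N <= m)%N ->
  pd (mk k s m j) x = 0.
Proof.
pose ht v := match v with VU (s,m,_) | VQ (s,m,_) | VW (s,m,_) => (s + m)%N | _ => 0%N end.
elim/salg_ind: x => [|c t x [N HN]]; first by exists 0%N => *; rewrite pd0.
exists (N + (\sum_(v <- t) ht v).+1)%N => k s m j hk h.
rewrite pdD pdZ HN ?addr0 //; last by lia.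
rewrite pd_notin ?scaler0 ?odd_mk //; apply/negP => /(big_rem _) e.
have := e _ _ _ xpredT ht; rewrite /= => {}e; move: h; rewrite e.
by case: k hk {e} => [[|]|] //= _; lia.
Qed.

(** Commuting the derivative by Z_(s,m+1) with the shift d/dx leaves the derivative by Z_(s,m), so
    descending induction on m kills all odd derivatives. In odd degree zero the constants would
    survive. *)
Lemma ddx_ker n x : odeg n.+1 x -> dd 1 x = 0 -> x = 0.
Proof.
move=> hx x0; apply: (odeg_pd0 hx).
have [N HN] := pd_bound x.
suff H k j s : k != None -> forall d m, (N <= m + d)%N -> pd (mk k s m j) x = 0.
  elim/dd_mk_ind => // k s m j; rewrite odd_mk => hk; apply: (H _ _ _ hk N); exact: leq_addl.
move=> hk; elim=> [|d IH] m hm; first by apply: HN => //; right; lia.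
have := pd_dx j hk s m.+1 x; rewrite x0 pd0 IH; last by lia.
by rewrite dd0 add0r /pl /= subn1.
Qed.

(* The derivative of the equation with respect to Z_(s+1,m+3) is
   - dx (d x/d Z_(s,m)) when all higher derivatives of x vanish. *)
Lemma chain_unique n x : odeg n.+2 x ->
  dd 1 (dd 0 x) - 4 *: (X Vx * dd 1 (dd 2 x)) + 2 *: dd 2 x + dd 1 (dd 1 (dd 1 (dd 2 x))) = 0 ->
  x = 0.
Proof.
move=> hx x0; apply: (odeg_pd0 hx); have [N HN] := pd_bound x.
(* Descending induction on s, and inside it on m: at (s,m) the derivatives with index s+1, or with
   index s and larger m, are already known to vanish. *)
suff H k j : k != None -> forall d s, (N <= s + d)%N -> forall m, pd (mk k s m j) x = 0.
  elim/dd_mk_ind => // k s m j; rewrite odd_mk => hk; apply: (H _ _ hk N); exact: leq_addl.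
move=> hk; elim=> [|d IHd] s hs m; first by apply: HN => //; left; lia.
have s1 r : pd (mk k s.+1 r j) x = 0 by apply: IHd; lia.
suff Hm e m' : (N <= m' + e)%N -> pd (mk k s m' j) x = 0 by apply: (Hm N); exact: leq_addl.
elim: e m' => [|e IHe] {}m hm; first by apply: HN => //; right; lia.
have z r : pd (mk k s (m + r.+1) j) x = 0 by apply: IHe; lia.
set a := pd (mk k s m j) x; pose b := pl k j s 1 m x.
have p0 r : pl k j s r (m + r) x = a by rewrite /pl leq_addl addnK.
have p1 r : pl k j s r (m + r).+1 x = 0.
  by rewrite /pl leqW ?leq_addl // -addSn addnK -addn1 z.
have p2 r : pl k j s r (m + r).+2 x = 0.
  by rewrite /pl !leqW ?leq_addl // -!addSn addnK -addn2 z.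
have p3 r : pl k j s r (m + r).+3 x = 0.
  by rewrite /pl !leqW ?leq_addl // -!addSn addnK -addn3 z.
have b1 : pl k j s 3 m.+2 x = b by rewrite /b /pl !ltnS !subSS.
pose P r y := pd (mk k s.+1 r j) y.
have PX r y : P r.+1 (dd 1 y) = dd 1 (P r.+1 y) + P r y.
  by rewrite /P pd_dx // /pl /= subn1.
have z0 : pl k j s 0 m.+3 x = 0 by have := p3 0%N; rewrite addn0.
have z1 : pl k j s 1 m.+3 x = 0 by have := p2 1%N; rewrite addn1.
have z3 : pl k j s 3 m.+3 x = a by have := p0 3%N; rewrite addn3.
have y0 : pl k j s 0 m.+2 x = 0 by have := p2 0%N; rewrite addn0.
have y1 : pl k j s 1 m.+2 x = 0 by have := p1 1%N; rewrite addn1.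
have w1 : pl k j s 1 m.+1 x = a by have := p0 1%N; rewrite addn1.
have Pt3 : P m.+3 (dd 0 x) = (1 / 2) *: a.
  by rewrite /P pd_dt // s1 dd0 add0r z0 z1 z3 mulr0 !scaler0 subr0 add0r.
have Pt2 : P m.+2 (dd 0 x) = (1 / 2) *: b.
  by rewrite /P pd_dt // s1 dd0 add0r b1 y0 y1 mulr0 !scaler0 subr0 add0r.
have Py3 : P m.+3 (dd 2 x) = 0 by rewrite /P pd_dy // s1 dd0 add0r z1 scaler0 oppr0.
have Py2 : P m.+2 (dd 2 x) = 0 by rewrite /P pd_dy // s1 dd0 add0r y1 scaler0 oppr0.
have Py1 : P m.+1 (dd 2 x) = - (1 / 2) *: a by rewrite /P pd_dy // s1 dd0 add0r w1 scaleNr.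
have Py0 : P m (dd 2 x) = - (1 / 2) *: b.
  by rewrite /P pd_dy // s1 dd0 add0r scaleNr.
(* The t-term contributes (1/2) dx a + (1/2) b. The term with three x-derivatives contributes, by
   binomial expansion, 3 dx of [Py1] plus [Py0], that is - (3/2) dx a - (1/2) b. The b cancel and -
   dx a remains. *)
have := congr1 (P m.+3) x0; rewrite /P !(pdD, pdN, pdZ, pd0) -/(P m.+3 _).
rewrite pd_even_mul ?odd_mk //; last 2 first.
- exact: (hdegX R odd_var Vx).
- by rewrite pdX ?odd_mk //; case: (k) => [[|]|].
rewrite -/(P _ _) -/(P _ _) -/(P _ _) !PX Pt3 Pt2 Py3 Py2 Py1 Py0 !(ddD, ddZ, dd0) => eq0.
(* [a] has odd degree n+1, hence positive, as [ddx_ker] requires. *)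
suff : dd 1 a = 0.
  apply: (@ddx_ker n); rewrite /a; apply: pd_odeg => //; by rewrite odd_mk.
move: eq0; rewrite !addr0 mulr0 => eq0.
transitivity (- (0 : salg R)); last exact: oppr0.
rewrite -{1}eq0.
linear_ring R (salg R).
Qed.

(* In the linearized system, d/dx (x f - g / 2) = f. *)
Lemma chain_pair n (f g : salg R) : odeg n.+2 f -> odeg n.+2 g ->
  dd 1 g - 2 *: (X Vx * dd 1 f) = 0 ->
  dd 2 g - (dd 0 f + dd 1 (dd 1 (dd 2 f)) - 2 *: (X Vx * dd 2 f)) = 0 ->
  f = 0 /\ g = 0.
Proof.
move=> hf hg h1 h2; pose p := X Vx * f - (1 / 2) *: g.
have hx : odeg 0 (X Vx) by exact: (hdegX R odd_var Vx).
have p1 : dd 1 p = f.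
  rewrite /p ddB ddZ ddM dd_Vx !mul1r; move/eqP: h1; rewrite subr_eq0 => /eqP ->.
  linear_ring R (salg R).
have p0 : p = 0.
  apply: (@chain_unique n).
    by apply: hdegB; [exact: (hdegM hx hf) | exact: hdegZ].
  have e1 : dd 1 (dd 0 p) = dd 0 f by rewrite (@dd_comm _ 1 0) // p1.
  have e2 : dd 1 (dd 2 p) = dd 2 f by rewrite (@dd_comm _ 1 2) // p1.
  (* Since dx p = f, the left side of the equation for [p] is minus the left side of the second
     hypothesis. *)
  rewrite e1 e2 {1}/p ddB ddZ ddM dd_Vx mul0r add0r.
  transitivity (- (0 : salg R)); last exact: oppr0.
  rewrite -{1}h2.
  linear_ring R (salg R).
have f0 : f = 0 by rewrite -p1 p0 dd0.
split=> //; have : 2 *: p = 0 by rewrite p0 scaler0.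
rewrite /p f0 mulr0 => e; transitivity (- (0 : salg R)); last exact: oppr0.
rewrite -{1}e.
linear_ring R (salg R).
Qed.
End ChainUniqueness.

(** * Passage from the linearized system to chain coordinates *)

Section ChainIso.
Variable R : numFieldType.
Local Notation X := (X R).
Implicit Types x y : salg R.
Local Notation G0 := (gens (1:R) 0).
Local Notation rd := (red (1:R) 0).

Definition dmsp (s : midx) (p : spoly R) : spoly R :=
  iter s.1.1 (der false (fd R 0)) (iter s.1.2 (der false (fd R 1)) (iter s.2 (der false (fd R 2)) p)).
Definition dms (s : midx) x : salg R := iter s.1.1 (@dd R 0) (iter s.1.2 (@dd R 1) (iter s.2 (@dd R 2) x)).
Lemma cls_dmsp s p : cls (dmsp s p) = dms s (cls p).
Proof.
have it d n q : cls (iter n (der false (fd R d)) q) = iter n (@dd R d) (cls q).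
  by elim: n => //= n <-; rewrite /dd Der_cls //; exact: fd_super.
by rewrite /dmsp /dms !it.
Qed.
Lemma dms_odeg s n x : odeg n x -> odeg n (dms s x).
Proof.
have it d m y : odeg n y -> odeg n (iter m (@dd R d) y) by move=> h; elim: m => //= m; exact: dd_odeg.
by move=> h; apply: (it); apply: (it); apply: (it).
Qed.
Lemma dd_dms d s x : (d < 3)%N -> dd d (dms s x) = dms (shift d s) x.
Proof.
have it e f n y : (e < 3)%N -> (f < 3)%N ->
    dd e (iter n (@dd R f) y) = iter n (@dd R f) (dd e y).
  by move=> he hf; elim: n => //= n <-; rewrite dd_comm.
by case: s => [[k i] j]; case: d => [|[|[|]]] //= _; rewrite /dms /= ?it.
Qed.

(** With z = x q - w/2 as bottom of the w chain, q is z_x and w is 2 x z_x - 2 z. Derivatives are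
    taken with the chain derivations, so that [theta] intertwines them with the total
    derivatives. *)
Definition thsp (v : var) : spoly R :=
  match v with
  | VU s => dmsp s (pv R (VU (0,0,0)%N))
  | VQ s => dmsp s (pv R (VW (0,1,0)%N))
  | VW s => dmsp s [:: (2, [:: Vx; VW (0,1,0)%N]); (-2, [:: VW (0,0,0)%N])]
  | _ => pv R v
  end.
Lemma th_spar : spar (fun v => cls (thsp v)).
Proof.
by case=> [| | |s|s|s] /=; rewrite ?cls_dmsp; try apply: dms_odeg; exact: odeg_expl.
Qed.
Definition theta := phi (fun v => cls (thsp v)).
HB.instance Definition _ := GRing.Linear.on theta.
Lemma thetaM x y : theta (x * y) = theta x * theta y. Proof. exact: phiM th_spar. Qed.
Lemma thetaD x y : theta (x + y) = theta x + theta y. Proof. exact: phiD. Qed.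
Lemma thetaB x y : theta (x - y) = theta x - theta y. Proof. exact: phiB. Qed.
Lemma thetaZ c x : theta (c *: x) = c *: theta x. Proof. exact: phiZ. Qed.
Lemma theta0 : theta 0 = 0. Proof. exact: phi_0. Qed.
Lemma thetaX v : theta (X v) = cls (thsp v). Proof. exact: phiX th_spar. Qed.
Lemma theta_odeg n x : odeg n x -> odeg n (theta x).
Proof. exact: phi_hdeg th_spar th_spar. Qed.
Lemma theta_D d x : (d < 3)%N -> theta (D d x) = dd d (theta x).
Proof.
move=> hd; apply: phi_Der th_spar (Dsuper R d) (fd_super R d) _ _ => v; rewrite -/theta -/(dd d).
have tX w : theta (cls (pv R w)) = cls (thsp w) by exact: thetaX.
case: v => [| | |s|s|s]; rewrite [Dvar _ _ _]/= ?tX [in RHS]/= ?cls_dmsp ?dd_dms //.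
all: rewrite -[cls (pv _ _)]/(X _) ddX.
all: by case: d hd => [|[|[|]]] //= _; rewrite ?theta0 // cls_pc thetaZ /theta phi1 //; exact: th_spar.
Qed.
Lemma theta_gens i : theta (nth 0 G0 i) = 0.
Proof.
case: i => [|[|[|[|i]]]]; last by rewrite /= nth_nil theta0.
all: rewrite /= /theta -cls_psubst; [|exact: th_spar].
all: rewrite -[RHS]cls0.
all: cbv [psubst thsp dmsp fd ft_mk ck mk gE gT gX gY rE rT rX rY].
all: spoly_field.
Qed.
Lemma theta_didl x : didl G0 x -> theta x = 0.
Proof.
elim/didl_ind=> [|y z hy hz|y s i]; first exact: theta0.
  by rewrite thetaD hy hz addr0.
rewrite thetaM (_ : theta (Dm s _) = 0) ?mulr0 //.
have it d n z : (d < 3)%N -> theta (iter n (D d) z) = iter n (@dd R d) (theta z).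
  by move=> d3; elim: n => //= n <-; rewrite theta_D.
have z0 d n : iter n (@dd R d) 0 = 0 by elim: n => //= n ->; rewrite dd0.
by rewrite /Dm !it // theta_gens !z0.
Qed.
Lemma theta_red x : theta (rd x) = theta x.
Proof.
apply/esym/eqP; rewrite -subr_eq0 -thetaB; apply/eqP/theta_didl; exact: sub_red_didl.
Qed.

Lemma rdP x y : didl G0 (x - y) -> rd x = rd y.
Proof. by move/red_eq0/eqP; rewrite redB subr_eq0 => /eqP. Qed.
Lemma rdPr x y : rd x = rd y -> didl G0 (x - y).
Proof. by move=> e; apply/red_eq0; rewrite redB e subrr. Qed.
Lemma rd_D d x y : (d < 3)%N -> rd x = rd y -> rd (D d x) = rd (D d y).
Proof. by move=> hd /rdPr h; apply: rdP; rewrite -DB; exact: didl_D. Qed.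

Section Hat.
Variables (k : option bool) (z0 : salg R).
(* z_s is determined by  dt z_s = (c + 2s) z_{s+1} + 4x dy z_s - dx^2 dy z_s. *)
Fixpoint hat (s : nat) : salg R :=
  if s is s'.+1 then
    (ck R k + 2 * s'%:R)^-1 *:
       (D 0 (hat s') - 4 *: (X Vx * D 2 (hat s')) + D 1 (D 1 (D 2 (hat s'))))
  else z0.
Definition hatP (v : R) z := D 0 (D 1 z) - (4 - 2 * v) *: D 2 z - 4 *: (X Vx * D 1 (D 2 z))
  + D 1 (D 1 (D 1 (D 2 z))).
Hypothesis P0 : didl G0 (hatP (ck R k) z0).

Lemma ck_neq0 s : ck R k + 2 * s%:R != 0.
Proof.
rewrite (_ : ck R k + 2 * s%:R = ((if k is None then 1 else 3) + 2 * s)%:R); last first.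
  by rewrite natrD natrM; case: (k).
by rewrite pnatr_eq0; case: (k).
Qed.
Lemma D_Vx d : D d (X Vx) = (d == 1%N)%:R.
Proof. by rewrite DX; case: d => [|[|d]] //=; rewrite cls_pc scale1r. Qed.

(** Write v for the parameter, z for the old member and z' for the new one. Applying D_x to the
    definition of z' gives D_x z' + 2 D_y z = hatP v z / v. The operator D_t - 4 x D_y + D_x^2 D_y
    applied to this left side is hatP (v + 2) z', because 4 - 2 (v + 2) = - 2 v and v D_y z' is
    known from the definition. *)
Lemma hat_step s : didl G0 (hatP (ck R k + 2 * s%:R) (hat s)) ->
  didl G0 (D 1 (hat s.+1) + 2 *: D 2 (hat s)) /\
  didl G0 (hatP (ck R k + 2 * s.+1%:R) (hat s.+1)).
Proof.
rewrite [hat s.+1]/=; have := ck_neq0 s; set v := ck R k + _; move: (hat s) => z v0 hP.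
pose y := D 0 z - 4 *: (X Vx * D 2 z) + D 1 (D 1 (D 2 z)).
rewrite -/y; set z' := v^-1 *: y.
have ey : y = v *: z' by rewrite scalerA mulfV // scale1r.
have ek : D 1 z' + 2 *: D 2 z = v^-1 *: hatP v z.
  rewrite /z' /y /hatP DZ !(DD, DB, DZ) DM D_Vx mul1r.
  rewrite -[2 *: D 2 z](_ : (v^-1 * (2 * v)) *: D 2 z = _); last by rewrite mulrCA mulVf // mulr1.
  rewrite (D_comm 1 0).
  linear_ring R (salg R).
clearbody z'.
have hk : didl G0 (D 1 z' + 2 *: D 2 z) by rewrite ek; exact: didlZ.
split=> //; set kk := D 1 z' + 2 *: D 2 z in hk.
have e1 : D 1 z' = kk - 2 *: D 2 z by rewrite /kk addrK.
suff -> : hatP (ck R k + 2 * s.+1%:R) z' = D 0 kk - 4 *: (X Vx * D 2 kk) + D 1 (D 1 (D 2 kk)).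
  apply: didlD; last by do 3 apply: didl_D => //.
  apply: didlB; first exact: didl_D.
  by apply: didlZ; apply: didlMl; exact: didl_D.
have ev : v *: D 2 z' = D 2 (D 0 z) - 4 *: (X Vx * D 2 (D 2 z)) + D 1 (D 1 (D 2 (D 2 z))).
  rewrite -DZ -ey /y !(DD, DB, DZ) DM D_Vx mul0r add0r.
  by rewrite !(D_comm 2 1).
rewrite /hatP (D_comm 1 2 z') !e1 !(DB, DZ) mulrBr -scalerAr (D_comm 0 2 z).
rewrite (_ : 4 - 2 * (ck R k + 2 * s.+1%:R) = - (2 * v)); last by rewrite /v; ring.
rewrite scaleNr -[(2 * v) *: _]scalerA ev.
linear_ring R (salg R).
Qed.
Lemma hat_P s : didl G0 (hatP (ck R k + 2 * s%:R) (hat s)).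
Proof.
elim: s => [|s IH]; first by rewrite mulr0 addr0.
by have [] := hat_step IH.
Qed.
Lemma hat_y s : rd (D 2 (hat s)) = rd (- (1 / 2) *: D 1 (hat s.+1)).
Proof.
apply: rdP; have [h _] := hat_step (hat_P s).
have := didlZ (1 / 2) h; congr (didl _ _).
linear_ring R (salg R).
Qed.
Lemma hat_t s : rd (D 0 (hat s)) = rd ((ck R k + 2 * s%:R) *: hat s.+1
  - 2 *: (X Vx * D 1 (hat s.+1)) + (1 / 2) *: D 1 (D 1 (D 1 (hat s.+1)))).
Proof.
apply: rdP; have [h _] := hat_step (hat_P s).
have -> : (ck R k + 2 * s%:R) *: hat s.+1 =
    D 0 (hat s) - 4 *: (X Vx * D 2 (hat s)) + D 1 (D 1 (D 2 (hat s))).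
  by rewrite /= scalerA mulfV ?ck_neq0 // scale1r.
have h2 : didl G0 (2 *: (X Vx * (D 1 (hat s.+1) + 2 *: D 2 (hat s)))
   - (1 / 2) *: D 1 (D 1 (D 1 (hat s.+1) + 2 *: D 2 (hat s)))).
  apply: didlB; apply: didlZ; first exact: didlMl.
  by do 2 apply: didl_D => //.
move: h2; move: (hat s.+1) (hat s) => z' z; congr (didl _ _); rewrite !(DD, DZ) mulrDr -scalerAr.
linear_ring R (salg R).
Qed.
End Hat.
End ChainIso.

(** * The inverse substitution modulo the linearized ideal *)

Section ChainInverse.
Variable R : numFieldType.
Local Notation X := (X R).
Implicit Types x y : salg R.
Local Notation G0 := (gens (1:R) 0).
Local Notation rd := (red (1:R) 0).

Definition hatPsp (v : R) (p : spoly R) : spoly R :=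
  padd (psub (psub (TD 0 (TD 1 p)) (pscale (4 - 2 * v) (TD 2 p)))
             (pscale 4 (pmul (pv R Vx) (TD 1 (TD 2 p))))) (TD 1 (TD 1 (TD 1 (TD 2 p)))).
Lemma hatP_cls v p : hatP v (cls p) = cls (hatPsp v p).
Proof. by rewrite /hatP /hatPsp !(clsD, clsB, clsZ, clsM, cls_TD). Qed.

Definition potsp : spoly R := [:: (1, [:: Vx; VQ (0,0,0)%N]); (- (1 / 2), [:: VW (0,0,0)%N])].

Lemma hatP_u : didl G0 (hatP (ck R None) (X (VU (0,0,0)%N))).
Proof.
rewrite hatP_cls; have -> : cls (hatPsp (ck R None) (pv R (VU (0,0,0)%N))) = cls (gE 1 0).
  by rewrite /hatPsp /ck /gE /rE; spoly_field.
exact: (@didl_gen _ G0 (0,0,0)%N 0).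
Qed.
(** The x-derivative of x q - w/2 is q - gX/2. Inserting it, everything that does not involve [gX]
    adds up to - gY, which gives the displayed combination. *)
Lemma hatP_pot : didl G0 (hatP (ck R (Some true)) (cls potsp)).
Proof.
rewrite hatP_cls; have -> : cls (hatPsp (ck R (Some true)) potsp) =
    cls (psub (padd (psub (pscale (- (1 / 2)) (TD 0 (gX 1 0))) (gY 1 0))
                    (pscale 2 (pmul (pv R Vx) (TD 2 (gX 1 0)))))
              (pscale (1 / 2) (TD 1 (TD 1 (TD 2 (gX 1 0)))))).
  by rewrite /hatPsp /potsp /ck /gX /gY /rX /rY; spoly_field.
have hX : didl G0 (cls (gX 1 0)) by exact: (@didl_gen _ G0 (0,0,0)%N 2).
have hY : didl G0 (cls (gY 1 0)) by exact: (@didl_gen _ G0 (0,0,0)%N 3).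
move: (gX 1 0) (gY 1 0) hX hY => gx gy hX hY; rewrite !(clsB, clsD, clsZ, clsM, cls_TD).
apply: didlB; last by apply: didlZ; do 3 apply: didl_D => //.
apply: didlD; last by apply: didlZ; apply: didlMl; exact: didl_D.
by apply: didlB => //; apply: didlZ; exact: didl_D.
Qed.

(** The chains are grown from u and from x q - w/2. [theta] takes no value involving the q family,
    which is sent to 0; the chain relations hold trivially there. *)
Definition etl (k : option bool) (s : nat) : salg R :=
  match k with
  | None => hat None (X (VU (0,0,0)%N)) s
  | Some true => hat (Some true) (cls potsp) s
  | Some false => 0
  end.
Lemma hat_odeg n k z s : odeg n z -> odeg n (@hat R k z s).
Proof.
move=> hz; elim: s => //= s IH; apply: hdegZ; apply: hdegD; last by do 3 apply: D_odeg.
apply: hdegB; first exact: D_odeg.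
by apply: hdegZ; apply: (odegM_eq (hdegX R odd_var Vx) (D_odeg 2 IH)).
Qed.
Definition etv (v : var) : salg R :=
  match v with
  | VU (s, m, _) => iter m (@D R 1) (etl None s)
  | VQ (s, m, _) => iter m (@D R 1) (etl (Some false) s)
  | VW (s, m, _) => iter m (@D R 1) (etl (Some true) s)
  | _ => X v
  end.
Lemma et_spar : spar etv.
Proof.
have it n m z : odeg n z -> odeg n (iter m (@D R 1) z) by move=> h; elim: m => //= m; exact: D_odeg.
case=> [| | |[[s m] j]|[[s m] j]|[[s m] j]] /=; try exact: hdegX; apply: it.
- by apply: hat_odeg; exact: (hdegX R odd_var (VU _)).
- exact: hdeg0.
- by apply: hat_odeg; exact: odeg_expl.
Qed.
Definition eta := phi etv.
HB.instance Definition _ := GRing.Linear.on eta.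
Lemma etaM x y : eta (x * y) = eta x * eta y. Proof. exact: phiM et_spar. Qed.
Lemma etaD x y : eta (x + y) = eta x + eta y. Proof. exact: phiD. Qed.
Lemma etaB x y : eta (x - y) = eta x - eta y. Proof. exact: phiB. Qed.
Lemma etaZ c x : eta (c *: x) = c *: eta x. Proof. exact: phiZ. Qed.
Lemma eta_0 : eta 0 = 0. Proof. exact: phi_0. Qed.
Lemma eta_1 : eta 1 = 1. Proof. exact: phi1 et_spar. Qed.
Lemma etaX v : eta (X v) = etv v. Proof. exact: phiX et_spar. Qed.
Lemma etaX_mk k s m j : eta (X (mk k s m j)) = iter m (@D R 1) (etl k s).
Proof. by rewrite etaX; case: k => [[|]|]. Qed.

Lemma etl_y k s : rd (D 2 (etl k s)) = rd (- (1 / 2) *: D 1 (etl k s.+1)).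
Proof.
case: k => [[|]|] /=; first exact: hat_y hatP_pot s.
  by rewrite !D_0 scaler0.
exact: hat_y hatP_u s.
Qed.
Lemma etl_t k s : rd (D 0 (etl k s)) = rd ((ck R k + 2 * s%:R) *: etl k s.+1
  - 2 *: (X Vx * D 1 (etl k s.+1)) + (1 / 2) *: D 1 (D 1 (D 1 (etl k s.+1)))).
Proof.
case: k => [[|]|]; first exact: hat_t hatP_pot s.
  by rewrite /etl !D_0 mulr0 !scaler0 subr0 addr0.
exact: hat_t hatP_u s.
Qed.
Lemma rd_iter m x y : rd x = rd y -> rd (iter m (@D R 1) x) = rd (iter m (@D R 1) y).
Proof. by move=> h; elim: m => //= m; exact: rd_D. Qed.
Lemma iterD1_x m z : iter m (@D R 1) (X Vx * z) =
  X Vx * iter m (@D R 1) z + m%:R *: iter m.-1 (@D R 1) z.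
Proof.
elim: m => [|m IH] /=; first by rewrite scale0r addr0.
rewrite IH DD DM D_Vx mul1r DZ -addrA addrCA; congr (_ + _).
by case: m {IH} => [|m] /=; rewrite ?scale0r ?addr0 ?scale1r // -[in RHS]natr1 scalerDl scale1r addrC.
Qed.

(** The intertwining is only modulo the ideal, as the relations for D_t and D_y along the chain come
    from the linearized equations. It is enough to check letters, both sides obeying the same
    Leibniz rule. *)
Lemma rd_eta_dd d x : (d < 3)%N -> rd (eta (dd d x)) = rd (D d (eta x)).
Proof.
move=> hd; apply: (@linear_ext _ _ (rd \o eta \o dd d) (rd \o D d \o eta)) => /=.
  by rewrite dd1 eta_1 D1 eta_0.
move=> v {}x IH; rewrite ddM !(etaD, etaM) DM !redD !redM IH; congr (_ * _ + _).
clear IH x.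
have cst w : eta (X w) = X w -> dd d (X w) = D d (X w) -> eta (D d (X w)) = D d (X w) ->
  rd (eta (dd d (X w))) = rd (D d (eta (X w))) by move=> -> -> ->.
have D01 (b : bool) : eta b%:R = b%:R by case: b; rewrite ?eta_1 ?eta_0.
elim/dd_mk_ind: v.
- by apply: cst; rewrite ?etaX // ?ddX ?DX; case: d hd => [|[|[|]]] //= _;
    rewrite ?cls_pc ?etaZ ?eta_1 ?eta_0.
- by apply: cst; rewrite ?etaX // ?ddX ?DX; case: d hd => [|[|[|]]] //= _;
    rewrite ?cls_pc ?etaZ ?eta_1 ?eta_0.
- by apply: cst; rewrite ?etaX // ?ddX ?DX; case: d hd => [|[|[|]]] //= _;
    rewrite ?cls_pc ?etaZ ?eta_1 ?eta_0.
move=> k s m j; have itZ n c z : iter n (@D R 1) (c *: z) = c *: iter n (@D R 1) z.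
  by elim: n => //= n ->; rewrite DZ.
have itD n y z : iter n (@D R 1) (y + z) = iter n (@D R 1) y + iter n (@D R 1) z.
  by elim: n => //= n ->; rewrite DD.
have itS n z : iter n (@D R 1) (D 1 z) = iter n.+1 (@D R 1) z by rewrite iterSr.
clear cst; case: d hd => [|[|[|]]] // _.
- rewrite ddt_mk !(etaD, etaB, etaZ, etaM) !etaX_mk etaX /= (iterD_comm 0 1).
  rewrite (rd_iter m (etl_t k s)) -scaleNr !itD !itZ iterD1_x !itS.
  (* At m = 0 the truncated predecessor does no harm, its coefficient being 0. *)
  have -> : m%:R *: iter m.-1.+1 (@D R 1) (etl k s.+1) = m%:R *: iter m (@D R 1) (etl k s.+1).
    by case: (m) => [|n]; rewrite ?scale0r.
  congr (rd _); rewrite /=.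
  linear_ring R (salg R).
- by rewrite ddx_mk !etaX_mk.
- rewrite ddy_mk etaZ !etaX_mk (iterD_comm 2 1) (rd_iter m (etl_y k s)) itZ itS.
  by [].
Qed.
Lemma rd_eta_dms s x : rd (eta (dms s x)) = rd (Dm s (eta x)).
Proof.
have it d n y z : (d < 3)%N -> rd (eta y) = rd z -> rd (eta (iter n (@dd R d) y)) = rd (iter n (D d) z).
  by move=> hd h; elim: n => //= n IH; rewrite rd_eta_dd //; exact: rd_D.
by apply: (it) => //; apply: (it) => //; apply: (it).
Qed.
Lemma rd_Dm s x y : rd x = rd y -> rd (Dm s x) = rd (Dm s y).
Proof. by move/rdPr => h; apply: rdP; rewrite -DmB; exact: didl_Dm. Qed.

Lemma rd_eta_theta x : rd (eta (theta x)) = rd x.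
Proof.
apply: (@hom_ext _ (rd \o eta \o @theta R) rd) => //=.
- by rewrite /theta phi1 ?eta_1 //; exact: th_spar.
- by move=> y z; rewrite thetaM etaM redM.
- exact: redM.
have potD : D 1 (cls potsp) = X (VQ (0,0,0)%N) - (1 / 2) *: cls (gX 1 0).
  rewrite -(clsZ (1 / 2)) /X -clsB -cls_TD /potsp /gX /rX; spoly_field.
have hX : didl G0 (cls (gX 1 0)) by exact: (@didl_gen _ G0 (0,0,0)%N 2).
have rq : rd (D 1 (cls potsp)) = rd (X (VQ (0,0,0)%N)).
  by apply: rdP; rewrite potD addrAC subrr add0r; apply: didlN; exact: didlZ.
have tX c v : eta (cls [:: (c, [:: v])]) = c *: etv v by rewrite cls1 etaZ etaX.
move=> v; rewrite thetaX; case: v => [| | |s|s|s] /=; rewrite ?tX ?scale1r // cls_dmsp rd_eta_dms.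
- by rewrite tX scale1r /= Dm_XU.
- rewrite tX scale1r -Dm_XQ; exact: rd_Dm.
rewrite -Dm_XW; apply: rd_Dm.
rewrite !cls_cons !wd_cons !wd_nil !mulr1 addr0 etaD !etaZ etaM !etaX /=.
rewrite redD !redZ redM rq -redM -!redZ -redD; congr (rd _).
rewrite /potsp !cls_cons !wd_cons !wd_nil !mulr1 cls0 addr0.
linear_ring R (salg R).
Qed.
(** [eta] is a left inverse of [theta] modulo the ideal, so vanishing found in chain coordinates can
    be brought back. *)
Lemma theta_inj x : theta x = 0 -> rd x = 0.
Proof. by move=> h; rewrite -rd_eta_theta h eta_0 red0. Qed.
End ChainInverse.

(** * Uniqueness of the symmetry with given u-component *)

Section Uniqueness.
Variable R : numFieldType.
Local Notation X := (X R).
Implicit Types x y f g : salg R.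
Local Notation ux := (X (VU (0,1,0)%N)).
Local Notation uy := (X (VU (0,0,1)%N)).

(* The equations for the pair of components along q and w of a symmetry whose
   u-component vanishes. *)
Definition pairX (a e : R) f g : salg R :=
  D 1 g - (2 * a) *: (X Vx * D 1 f) - (2 * e) *: (ux * D 1 f).
Definition pairY (a e : R) f g : salg R :=
  D 2 g - (D 0 f + D 1 (D 1 (D 2 f)) - (2 * a) *: (X Vx * D 2 f)
    - (2 * e) *: (ux * D 2 f + uy * D 1 f)).

Lemma pairX_didl G a e f g : didl G f -> didl G g -> didl G (pairX a e f g).
Proof.
move=> hf hg; apply: didlB; [apply: didlB|]; try apply: didlZ; try apply: didlMl; exact: didl_D.
Qed.
Lemma pairY_didl G a e f g : didl G f -> didl G g -> didl G (pairY a e f g).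
Proof.
move=> hf hg; apply: didlB; first exact: didl_D.
apply: didlB; [apply: didlB; [apply: didlD|]|].
- exact: didl_D.
- by do 3 apply: didl_D => //.
- by apply: didlZ; apply: didlMl; exact: didl_D.
- by apply: didlZ; apply: didlD; apply: didlMl; exact: didl_D.
Qed.
Lemma pairX_sub a e f g f' g' : pairX a e (f - f') (g - g') = pairX a e f g - pairX a e f' g'.
Proof. rewrite /pairX !DB !mulrBr; linear_ring R (salg R). Qed.
Lemma pairY_sub a e f g f' g' : pairY a e (f - f') (g - g') = pairY a e f g - pairY a e f' g'.
Proof. rewrite /pairY !DB !mulrBr; linear_ring R (salg R). Qed.

Lemma gr_Vx d x : gr d (X Vx * x) = X Vx * gr d x.
Proof. by rewrite (gr_hM _ _ (hdegX R isU Vx)) subn0. Qed.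
Lemma fil_U s d x : fil d x -> forall e, (e <= d)%N -> gr e (X (VU s) * x) = 0.
Proof.
move=> hx e he; rewrite (gr_hM _ _ (hdegX R isU (VU s))) /=; case: ifP => // e1.
by rewrite hx ?mulr0 //; lia.
Qed.
Lemma fil_D d i x : fil d x -> fil d (D i x).
Proof. by move=> hx e he; rewrite gr_D hx // D_0. Qed.
(** The terms carrying an explicit u_x start in degree d + 1, so up to degree d the equation is the
    linearized one. *)
Lemma gr_pairX d e f g : fil d f -> (e <= d)%N ->
  gr e (pairX 1 1 f g) = pairX 1 0 (gr e f) (gr e g).
Proof.
move=> hf he; rewrite /pairX !grB !grZ gr_Vx (fil_U _ (fil_D _ hf)) // !gr_D.
by rewrite mulr0 !scaler0 scale0r.
Qed.
Lemma gr_pairY d e f g : fil d f -> (e <= d)%N ->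
  gr e (pairY 1 1 f g) = pairY 1 0 (gr e f) (gr e g).
Proof.
move=> hf he; rewrite /pairY !(grB, grD, grZ) gr_Vx !(fil_U _ (fil_D _ hf)) // !gr_D.
by rewrite addr0 mulr0 !scaler0 scale0r.
Qed.

Lemma linear_pair n f g : odeg n.+2 f -> odeg n.+2 g ->
  red (1:R) 0 (pairX 1 0 f g) = 0 -> red (1:R) 0 (pairY 1 0 f g) = 0 ->
  red (1:R) 0 f = 0 /\ red (1:R) 0 g = 0.
Proof.
move=> hf hg hX hY.
have [] := @chain_pair R n (theta f) (theta g) (theta_odeg hf) (theta_odeg hg).
- rewrite -(@theta0 R) -hX theta_red /pairX !(thetaB, thetaZ, thetaM, theta_D, thetaX) //.
  by rewrite !mulr0 scale0r subr0 mulr1.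
- rewrite -(@theta0 R) -hY theta_red /pairY !(thetaD, thetaB, thetaZ, thetaM, theta_D, thetaX) //.
  by rewrite !mulr0 scale0r subr0 mulr1.
by move=> /theta_inj -> /theta_inj ->.
Qed.

(* Induction on the degree in the letters u: the lowest component solves the
   linearized system. *)
Lemma reduced_pair n f g : odeg n.+2 f -> odeg n.+2 g -> red 1 1 f = f -> red 1 1 g = g ->
  red (1:R) 1 (pairX 1 1 f g) = 0 -> red (1:R) 1 (pairY 1 1 f g) = 0 -> f = 0 /\ g = 0.
Proof.
move=> hf hg fK gK eX eY.
suff H d : fil d f /\ fil d g.
  by split; apply: gr_eq0 => e; have [h1 h2] := H e.+1; [exact: h1 | exact: h2].
elim: d => [|d [Hf Hg]]; first by split.
have fX : fil d (pairX 1 1 f g).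
  by move=> e he; rewrite (gr_pairX _ Hf) ?(ltnW he) // Hf // Hg // /pairX !D_0 !mulr0 !scaler0 !subr0.
have fY : fil d (pairY 1 1 f g).
  by move=> e he; rewrite (gr_pairY _ Hf) ?(ltnW he) // Hf // Hg // /pairY !D_0 !(mulr0, scaler0, addr0, subr0).
have [] := @linear_pair n (gr d f) (gr d g).
- exact: hdeg_gr_odeg.
- exact: hdeg_gr_odeg.
- by rewrite -(gr_pairX _ Hf) //; have := lead_red fX (leqnn d); rewrite eX gr0 eqxx.
- by rewrite -(gr_pairY _ Hf) //; have := lead_red fY (leqnn d); rewrite eY gr0 eqxx.
(* As [f] and [g] are normal forms, their degree d components equal their own linear normal forms,
   which have just been shown to vanish. *)
have := lead_red Hf (leqnn d); have := lead_red Hg (leqnn d).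
rewrite eqxx fK gK => <- <- e1 e2; split=> e; rewrite ltnS leq_eqVlt => /predU1P[->|] //.
- exact: Hf.
- exact: Hg.
Qed.

(** Replacing f and g by their normal forms alters the pair equations only by members of the ideal,
    and makes the degree induction applicable. *)
Lemma shifted_pair n f g : odeg n.+2 f -> odeg n.+2 g ->
  didl (gens (1:R) 1) (pairX 1 1 f g) -> didl (gens (1:R) 1) (pairY 1 1 f g) ->
  didl (gens (1:R) 1) f /\ didl (gens (1:R) 1) g.
Proof.
move=> hf hg hX hY; rewrite -!(red_eq0 _ _ (_ : salg R)) ; set f' := red 1 1 f; set g' := red 1 1 g.
have hf' : odeg n.+2 f' by apply: phi_hdeg hf; exact: nform_spar.
have hg' : odeg n.+2 g' by apply: phi_hdeg hg; exact: nform_spar.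
have eX : red 1 1 (pairX 1 1 f' g') = 0.
  apply/red_eq0; rewrite -[pairX _ _ _ _](subKr (pairX 1 1 f g)); apply: didlB => //.
  by rewrite -pairX_sub; apply: pairX_didl; exact: sub_red_didl.
have eY : red 1 1 (pairY 1 1 f' g') = 0.
  apply/red_eq0; rewrite -[pairY _ _ _ _](subKr (pairY 1 1 f g)); apply: didlB => //.
  by rewrite -pairY_sub; apply: pairY_didl; exact: sub_red_didl.
have [-> ->] // := @reduced_pair n f' g' hf' hg' (red_idem _ _ f) (red_idem _ _ g) eX eY.
Qed.

(** The substitution [tau 1] sends u_x to x + u_x and fixes u_y, hence carries the pair equations of
    W to those of the shifted system; [tau_didl] carries ideal membership both ways. *)
Lemma pair_unique n f g : odeg n.+2 f -> odeg n.+2 g ->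
  didl (gens (0:R) 1) (pairX 0 1 f g) -> didl (gens (0:R) 1) (pairY 0 1 f g) ->
  didl (gens (0:R) 1) f /\ didl (gens (0:R) 1) g.
Proof.
move=> hf hg hX hY; rewrite !tau_didl; move: hX hY; rewrite !tau_didl => hX hY.
have tD x y : tau 1 (x + y) = tau 1 x + tau 1 y by exact: phiD.
have tB x y : tau 1 (x - y) = tau 1 x - tau 1 y by exact: phiB.
have tZ c x : tau 1 (c *: x) = c *: tau 1 x by exact: phiZ.
have tux : tau 1 ux = X Vx + ux.
  by rewrite tauX /= !cls_cons !wd_cons !wd_nil !mulr1 cls0 addr0 !scale1r addrC.
have tuy : tau 1 uy = uy by rewrite tauX.
apply: (@shifted_pair n).
- by apply: phi_hdeg hf; exact: tau_spar.
- by apply: phi_hdeg hg; exact: tau_spar.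
- move: hX; congr (didl _ _).
  rewrite /pairX !(tB, tZ, tauM, tau_D) // tux mulr0 !scale0r [(X Vx + ux) * _]mulrDl.
  linear_ring R (salg R).
- move: hY; congr (didl _ _).
  rewrite /pairY !(tD, tB, tZ, tauM, tau_D) // tux tuy mulr0 !scale0r [(X Vx + ux) * _]mulrDl.
  linear_ring R (salg R).
Qed.
End Uniqueness.

(** * The explicit symmetry and the bracket *)

Section Symmetry.
Variable R : numFieldType.
Local Notation X := (X R).
Local Notation ux := (X (VU (0,1,0)%N)).
Local Notation uy := (X (VU (0,0,1)%N)).
Local Notation q0 := (X (VQ (0,0,0)%N)).
Local Notation qx := (X (VQ (0,1,0)%N)).
Local Notation qy := (X (VQ (0,0,1)%N)).
Local Notation I := (didl (gens (0:R) 1)).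

Lemma gensW_gens : map (@cls R) (gensW R) = gens (0:R) 1.
Proof.
rewrite -[LHS]/[:: cls (Defs.eqE R); cls (eqTE R); cls (eqWx R); cls (eqWy R)] /gens.
congr [:: _; _; _; _]; rewrite /Defs.eqE /eqTE /eqWx /eqWy /gE /gT /gX /gY /rE /rT /rX /rY; spoly_norm.
Qed.

(** The hypothesis constrains coefficients and not words. Words of another odd degree may be
    dropped: sorting keeps the odd degree, so they contribute only to coefficients that vanish. *)
Lemma odd_deg2_odeg (b : spoly R) : odd_deg2 b -> odeg 2 (cls b).
Proof.
move=> hb; exists (filter (fun tm => count odd_var tm.2 == 2)%N b); last exact: filter_all.
apply/clsP=> m; rewrite /coeff big_filter.
case: (eqVneq (count odd_var m) 2%N) => [m2|m2]; last first.
  rewrite -/(coeff b m) hb // big1 // => tm h; case: eqP => // e; case/negP: m2.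
  by rewrite -e (permP (_ : perm_eq (nf tm.2) tm.2)) ?perm_sort.
rewrite [RHS]big_mkcond; apply: eq_bigr => tm _; case: ifP => // h; case: eqP => // e.
have cn : count odd_var (nf tm.2) = count odd_var tm.2 by apply/permP; rewrite perm_sort.
by case: e; rewrite -cn (eqP h).
Qed.

Section Ev.
Variables (a b c : spoly R).
Lemma cls_ev_cons k s p : cls (ev a b c ((k, s) :: p)) =
  k *: cls (der_word true (Evar a b c) s) + cls (ev a b c p).
Proof. by rewrite /ev /der /= -[_ ++ _]/(padd _ _) clsD clsZ. Qed.
Definition evl (v : var) : salg R :=
  match v with VU s => Dm s (cls a) | VQ s => Dm s (cls b) | VW s => Dm s (cls c) | _ => 0 end.
Lemma cls_Evar v : cls (Evar a b c v) = evl v.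
Proof. by case: v => * //=; rewrite ?cls_Dms. Qed.
End Ev.

(** The odd field with components P, B, C applied to the relation for w_x. There is no Koszul sign,
    since the field passes only the even letter u_x. *)
Definition symX P B C : salg R := D 1 C - 2 *: (D 1 P * qx + ux * D 1 B).
Definition symY P B C : salg R :=
  D 2 C - (D 0 B + D 1 (D 1 (D 2 B)) - 2 *: (D 1 P * qy + ux * D 2 B)
           - 2 *: (D 2 P * qx + uy * D 1 B)).
Lemma ev_eqWx a b c : cls (ev a b c (eqWx R)) = symX (cls a) (cls b) (cls c).
Proof.
have -> : eqWx R = [:: (1, [:: VW (0,1,0)%N]); (-1 * (2 * (1 * 1)), [:: VU (0,1,0)%N; VQ (0,1,0)%N])] by [].
rewrite !cls_ev_cons !cls_der_word !cls_Evar /= !wd_cons !wd_nil !cls0 !mulr1 /Dm /= expr0 !mulr0 !scaler0 !addr0.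
rewrite /symX scale1r; linear_ring R (salg R).
Qed.
Lemma ev_eqWy a b c : cls (ev a b c (eqWy R)) = symY (cls a) (cls b) (cls c).
Proof.
have -> : eqWy R = [:: (1, [:: VW (0,0,1)%N]); (-1 * 1, [:: VQ (1,0,0)%N]); (-1 * 1, [:: VQ (0,2,1)%N]);
  (-1 * (-1 * (2 * (1 * 1))), [:: VU (0,1,0)%N; VQ (0,0,1)%N]);
  (-1 * (-1 * (2 * (1 * 1))), [:: VU (0,0,1)%N; VQ (0,1,0)%N])] by [].
rewrite !cls_ev_cons !cls_der_word !cls_Evar /= !wd_cons !wd_nil !cls0 !mulr1 /Dm /= expr0 !mulr0 !scaler0 !addr0.
rewrite /symY; linear_ring R (salg R).
Qed.

Definition nijh (mu : R) P B C : salg R :=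
  let g := cls (gam mu) in
  2 *: (g * (D 1 P * q0 + ux * B)) - mu *: (X Vy * B) - g * D 1 (D 1 B) + g * C.
Lemma ev_rho mu a b c : cls (ev a b c (rho mu)) = nijh mu (cls a) (cls b) (cls c).
Proof.
have -> : rho mu = [:: (2 * (1 * 1) * 1, [:: VU (0,1,0)%N; VQ (0,0,0)%N]);
    (2 * (- mu * 1 * 1) * 1, [:: Vt; VU (0,1,0)%N; VQ (0,0,0)%N]);
    (-1 * (mu * 1) * 1, [:: Vy; VQ (0,0,0)%N]); (-1 * (1 * 1), [:: VQ (0,2,0)%N]);
    (-1 * (- mu * 1 * 1), [:: Vt; VQ (0,2,0)%N]); (1 * 1, [:: VW (0,0,0)%N]);
    (- mu * 1 * 1, [:: Vt; VW (0,0,0)%N])] by [].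
rewrite !cls_ev_cons !cls_der_word !cls_Evar /= !wd_cons !wd_nil ?cls0 !mulr1 /Dm /=.
rewrite !expr0 !scale1r !(mulr0, mul0r, scaler0, addr0, add0r) /nijh.
have -> : cls (gam mu) = 1 - mu *: X Vt by rewrite /gam clsD clsZ cls_pc scale1r scaleNr.
rewrite !mulrBl !mul1r -!scalerAl !mulrDr.
linear_ring R (salg R).
Qed.

(** Two symmetries with a common u-component differ by a solution of the pair equations; this is
    what brings [pair_unique] to bear. *)
Lemma symX_sub P B C B' C' : symX P B C - symX P B' C' = pairX 0 1 (B - B') (C - C').
Proof. rewrite /symX /pairX !DB !mulrBr; linear_ring R (salg R). Qed.
Lemma symY_sub P B C B' C' : symY P B C - symY P B' C' = pairY 0 1 (B - B') (C - C').
Proof. rewrite /symY /pairY !DB !mulrBr; linear_ring R (salg R). Qed.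

Lemma symX_cls p b c : symX (cls p) (cls b) (cls c) =
  cls (psub (TD 1 c) (pscale 2 (padd (pmul (TD 1 p) (pv R (VQ (0,1,0)%N)))
                                     (pmul (pv R (VU (0,1,0)%N)) (TD 1 b))))).
Proof. by rewrite /symX !(clsB, clsD, clsZ, clsM, cls_TD). Qed.
Lemma symY_cls p b c : symY (cls p) (cls b) (cls c) =
  cls (psub (TD 2 c) (psub (psub (padd (TD 0 b) (TD 1 (TD 1 (TD 2 b))))
         (pscale 2 (padd (pmul (TD 1 p) (pv R (VQ (0,0,1)%N))) (pmul (pv R (VU (0,1,0)%N)) (TD 2 b)))))
         (pscale 2 (padd (pmul (TD 2 p) (pv R (VQ (0,1,0)%N))) (pmul (pv R (VU (0,0,1)%N)) (TD 1 b)))))).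
Proof. by rewrite /symY !(clsB, clsD, clsZ, clsM, cls_TD). Qed.
Definition nijsp (mu : R) p b c : spoly R :=
  padd (psub (psub (pscale 2 (pmul (gam mu) (padd (pmul (TD 1 p) (pv R (VQ (0,0,0)%N)))
                                               (pmul (pv R (VU (0,1,0)%N)) b))))
    (pscale mu (pmul (pv R Vy) b))) (pmul (gam mu) (TD 1 (TD 1 b)))) (pmul (gam mu) c).
Lemma nijh_cls mu p b c : nijh mu (cls p) (cls b) (cls c) = cls (nijsp mu p b c).
Proof.
rewrite /nijh /nijsp; move: (gam mu) => g.
by rewrite !(clsB, clsD, clsZ, clsM, cls_TD).
Qed.

(* The q- and w-components of the symmetry with u-component rho: the former is
   - d_C rho, and the latter integrates the equation for w. *)
Definition Sq (mu : R) : spoly R := pscale 2 (pmul (gam mu) (pmul (Q R 0 0 0) (Q R 0 1 0))).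
Definition Sw (mu : R) : spoly R :=
  padd (pscale 4 (pmul (gam mu) (pmul (U R 0 1 0) (pmul (Q R 0 0 0) (Q R 0 1 0)))))
       (pscale 2 (pmul (gam mu) (pmul (Q R 0 1 0) (Q R 0 2 0)))).

Lemma I_gen (i : nat) p : nth 0 (gens (0:R) 1) i = cls p -> I (cls p).
Proof. by move=> <-; exact: (@didl_gen _ _ (0,0,0)%N i). Qed.
Lemma I_gT : I (cls (gT 0 1)). Proof. exact: (@I_gen 1). Qed.
Lemma I_gX : I (cls (gX 0 1)). Proof. exact: (@I_gen 2). Qed.
Lemma I_gY : I (cls (gY 0 1)). Proof. exact: (@I_gen 3). Qed.

Lemma I_mul p q r : I (cls q) -> I (cls (pmul p (pmul q r))).
Proof.
move=> hq; rewrite !clsM; apply: didlMl; apply: didlMr => //; exact: gens_homog.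
Qed.

Lemma symX_S mu : I (symX (cls (rho mu)) (cls (Sq mu)) (cls (Sw mu))).
Proof.
rewrite symX_cls; set p := (X in cls X).
(* D_x rho contributes the term - 2 g w_x q_x; replacing w_x by [gX] there costs nothing, because
   q_x q_x = 0. *)
have -> : cls p = cls (pscale (- 2) (pmul (gam mu) (pmul (gX 0 1) (Q R 0 1 0)))).
  by rewrite /p /rho /Sq /Sw /gX /rX; spoly_norm.
rewrite clsZ; apply: didlZ; apply: I_mul; exact: I_gX.
Qed.
Lemma symY_S mu : I (symY (cls (rho mu)) (cls (Sq mu)) (cls (Sw mu))).
Proof.
rewrite symY_cls; set p := (X in cls X).
(* w_x and w_y enter through D_x rho and D_y rho, and q_tx through D_t of [Sq]; each is matched with
   its own relation. *)
pose pX := pmul (gam mu) (pmul (gX 0 1) (Q R 0 0 1)).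
pose pY := pmul (gam mu) (pmul (gY 0 1) (Q R 0 1 0)).
pose pT := pmul (gam mu) (pmul (gT 0 1) (Q R 0 0 0)).
have -> : cls p = cls (pscale 2 (padd (padd pX pY) pT)).
  by rewrite /p /pX /pY /pT /rho /Sq /Sw /gX /gY /gT /rX /rY /rT; spoly_norm.
rewrite clsZ !clsD; apply: didlZ; apply: didlD; first apply: didlD; apply: I_mul.
- exact: I_gX.
- exact: I_gY.
- exact: I_gT.
Qed.
Lemma nij_S mu mu' : I (nijh mu' (cls (rho mu)) (cls (Sq mu)) (cls (Sw mu))
  + nijh mu (cls (rho mu')) (cls (Sq mu')) (cls (Sw mu'))).
Proof.
rewrite !nijh_cls -clsD; set p := (X in cls X).
have -> : cls p = cls (pscale 4 (pmul (pmul (gam mu) (gam mu')) (pmul (gX 0 1) (Q R 0 0 0)))).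
  by rewrite /p /nijsp /rho /Sq /Sw /gX /rX; spoly_norm.
rewrite clsZ; apply: didlZ; apply: I_mul; exact: I_gX.
Qed.

Lemma Sq_odeg mu : odeg 2 (cls (Sq mu) : salg R). Proof. exact: odeg_expl. Qed.
Lemma Sw_odeg mu : odeg 2 (cls (Sw mu) : salg R). Proof. exact: odeg_expl. Qed.

Lemma sym_unique mu (b c : spoly R) : odd_deg2 b -> odd_deg2 c -> is_symW (rho mu) b c ->
  I (cls b - cls (Sq mu)) /\ I (cls c - cls (Sw mu)).
Proof.
move=> hb hc hs; apply: (@pair_unique R 0).
- by apply: hdegB; [exact: odd_deg2_odeg | exact: Sq_odeg].
- by apply: hdegB; [exact: odd_deg2_odeg | exact: Sw_odeg].
- rewrite -(symX_sub (cls (rho mu))); apply: didlB; last exact: symX_S.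
  rewrite -ev_eqWx -gensW_gens; apply/in_IWE; apply: hs.
  by rewrite !inE eqxx !orbT.
- rewrite -(symY_sub (cls (rho mu))); apply: didlB; last exact: symY_S.
  rewrite -ev_eqWy -gensW_gens; apply/in_IWE; apply: hs.
  by rewrite !inE eqxx !orbT.
Qed.

(** With the u-component fixed, the action on rho depends on the other components only modulo the
    ideal, so given symmetries may be replaced by the explicit ones. *)
Lemma nijh_sub mu P B C B' C' : I (B - B') -> I (C - C') -> I (nijh mu P B C - nijh mu P B' C').
Proof.
move=> hB hC; rewrite /nijh; move: (cls (gam mu)) => g.
have -> : 2 *: (g * (D 1 P * q0 + ux * B)) - mu *: (X Vy * B) - g * D 1 (D 1 B) + g * C
   - (2 *: (g * (D 1 P * q0 + ux * B')) - mu *: (X Vy * B') - g * D 1 (D 1 B') + g * C')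
   = 2 *: (g * (ux * (B - B'))) - mu *: (X Vy * (B - B')) - g * D 1 (D 1 (B - B')) + g * (C - C').
  by rewrite !DB !mulrDr !mulrN; linear_ring R (salg R).
apply: didlD; last exact: didlMl.
apply: didlB; last by apply: didlMl; do 2 apply: didl_D => //.
by apply: didlB; apply: didlZ; do ?apply: didlMl.
Qed.
End Symmetry.

(* For all mu, mu': whenever S_rho = (rho_mu, b, c) and S_rho' = (rho_mu', b', c')
   are the odd symmetries of W with u-components rho_mu, rho_mu'
   (odd, i.e. raising the odd degree by one: b, c, b', c' of odd degree 2),
   the Nijenhuis bracket S_rho(rho') + S_rho'(rho) vanishes on W. *)
Theorem theorem1 (R : realType) (mu mu' : R) (b c b' c' : spoly R) :
  odd_deg2 b -> odd_deg2 c -> odd_deg2 b' -> odd_deg2 c' ->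
  is_symW (rho mu) b c -> is_symW (rho mu') b' c' ->
  in_IW (nij (rho mu) b c (rho mu') b' c').
Proof.
move=> hb hc hb' hc' hs hs'.
have [eb ec] := sym_unique hb hc hs; have [eb' ec'] := sym_unique hb' hc' hs'.
apply/in_IWE; rewrite gensW_gens /nij clsD !ev_rho.
have h := nijh_sub mu' (cls (rho mu)) eb ec.
have h' := nijh_sub mu (cls (rho mu')) eb' ec'.
have := didlD (didlD h h') (nij_S mu mu').
by congr (didl _ _); rewrite addrACA !subrK.
Qed.
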